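(* Let $\Omega\subset\mathbb R^d$ be open and let $\omega\in\mathcal W$ be a fixed weight function. Then a function $\phi$ on $\Omega$ belongs to $\mathcal D^{\{\omega\}}(\Omega)$ if and only if for every compact set $K\subset\Omega$ and every $\omega'\in\mathcal W$ with $\omega'\ll\omega$ one has $\|\phi\|_{K,1}^{\omega'}<\infty$.
   Context: $\mathbb R^+=[0,\infty)$. $\mathcal W$ is the set of all nondecreasing continuous functions $\omega:\mathbb R^+\to\mathbb R^+$ such that $\omega(0)=0$; $\omega(x+y)\le\omega(x)+\omega(y)$ for all $x,y\ge 0$; $\int_1^\infty \frac{\omega(t)}{t^2}\,dt<\infty$; and $\lim_{t\to\infty}\frac{\omega(t)}{\log(1+t)}=\infty$. For $\omega_1,\omega_2\in\mathcal W$, $\omega_1\ll\omega_2$ means $\omega_1(t)=o(\omega_2(t))$ as $t\to\infty$. Functions are complex-valued and identified when equal almost everywhere. For a compactly supported function $f$ on $\mathbb R^d$, $\sigma\in\mathcal W$ and $l>0$, put $\|f\|_l^{\sigma}=\int_{\mathbb R^d}|\hat f(\xi)|e^{l\sigma(|\xi|)}\,d\xi\in[0,\infty]$, where $\hat f$ is the Fourier transform (with value $\infty$ if $f$ is not integrable). $\mathcal D^{\{\omega\}}(\Omega)$ (Roumieu test functions) is the set of functions $f$ with compact support in $\Omega$ such that $\|f\|_l^{\omega}<\infty$ for some $l>0$. For a function $f$ on $\Omega$, not necessarily compactly supported, and compact $K\subset\Omega$, $\|f\|_{K,l}^{\sigma}$ denotes the infimum of $\|\psi f\|_l^{\sigma}$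 over all $\psi\in\mathcal D^{\{\omega\}}(\Omega)$ equal to $1$ on $K$ (where $\psi f$ is extended by $0$ outside $\Omega$); if $f$ has support in $K$ this is just $\|f\|_l^{\sigma}$.
   Formalization: The function φ is assumed to have compact support in Ω (up to null sets); without this the equivalence is false, e.g. φ = 1 on a nonempty Ω has all the norms finite but is not compactly supported. *)

(* Defs.v *)
From HB Require Import structures.
From mathcomp Require Import all_boot all_order all_algebra.
From mathcomp Require Import complex.
From mathcomp Require Import all_classical all_reals all_analysis.

Set Implicit Arguments.
Unset Strict Implicit.
Unset Printing Implicit Defensive.

Import Order.TTheory GRing.Theory Num.Theory.
Import numFieldNormedType.Exports.
Import ComplexField.Normc.

Local Open Scope classical_set_scope.
Local Open Scope complex_scope.
Local Open Scope ring_scope.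

Definition rV_display : measure_display.
Proof. exact: (measure_tuple_display default_measure_display). Qed.

(* The sigma-algebra generated by the coordinate functions, i.e. the Borel
   sigma-algebra of R^n. *)
Section rV_measurable.
Context {R : realType} {n : nat}.

Let coords (i : 'I_n) (x : 'rV[R]_n) : measurableTypeR R := x 0 i.

Let rV_set0 : g_sigma_preimage coords set0.
Proof. exact: sigma_algebra0. Qed.

Let rV_setC A : g_sigma_preimage coords A -> g_sigma_preimage coords (~` A).
Proof. exact: sigma_algebraC. Qed.

Let rV_bigcup (F : _^nat) : (forall i, g_sigma_preimage coords (F i)) ->
  g_sigma_preimage coords (\bigcup_i (F i)).
Proof. exact: sigma_algebra_bigcup. Qed.

HB.instance Definition _ := @isMeasurable.Build rV_display
  'rV[R]_n (g_sigma_preimage coords) rV_set0 rV_setC rV_bigcup.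

End rV_measurable.

Section rV_lebesgue.
Context {R : realType}.

Definition rV_rcons n (p : 'rV[R]_n * measurableTypeR R) : 'rV[R]_n.+1 :=
  \row_i oapp (p.1 0) p.2 (unlift ord_max i).

Lemma measurable_coord n (i : 'I_n) :
  measurable_fun [set: 'rV[R]_n] (fun x => x 0 i : measurableTypeR R).
Proof.
move=> _ Y mY; rewrite setTI; apply: sub_sigma_algebra => /=.
rewrite -bigcup_seq/=; exists i => /=; first by rewrite mem_index_enum.
by exists Y => //; rewrite setTI.
Qed.

Lemma measurable_rV_rcons n : measurable_fun [set: _] (@rV_rcons n).
Proof.
move=> _ A mA; rewrite setTI; move: A mA; apply: smallest_sub.
  split => [|A|F]; first by rewrite preimage_set0.
  - by move=> mA; rewrite setTD preimage_setC; exact: measurableC.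
  - by move=> mF; rewrite preimage_bigcup; exact: bigcup_measurable.
move=> A; rewrite -bigcup_seq/= => -[i _ [B mB <-]]; rewrite setTI.
rewrite -comp_preimage -[X in measurable X]setTI.
suff mi : measurable_fun setT
    ((fun x : 'rV[R]_n.+1 => x 0 i : measurableTypeR R) \o @rV_rcons n).
  exact: mi.
have [j ->|->] := unliftP ord_max i.
- apply: (eq_measurable_fun ((fun x : 'rV[R]_n => x 0 j) \o fst)).
    by move=> p _ /=; rewrite mxE liftK.
  exact: (measurableT_comp (measurable_coord j)).
- apply: (eq_measurable_fun snd); last exact: measurable_snd.
  by move=> p _ /=; rewrite mxE unlift_none.
Qed.

Fixpoint lebesgue_rV n : set 'rV[R]_n -> \bar R :=
  if n is n'.+1
  then pushforward (@lebesgue_rV n' \x lebesgue_measure)%E (@rV_rcons n')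
  else \d_(0 : 'rV[R]_0).
Arguments lebesgue_rV n _ : clear implicits.

Let lebesgue_rV_measure n :
  {m : {measure set 'rV[R]_n -> \bar R} | lebesgue_rV n = m}.
Proof.
elim: n => [|n [m mE]] /=; first by exists \d_(0 : 'rV[R]_0).
exists (measure_function_pushforward__canonical__measure_function_Measure
  (m \x lebesgue_measure)%E (@measurable_rV_rcons n)).
by rewrite mE.
Qed.

Let lebesgue_rV0 n : lebesgue_rV n set0 = 0%E.
Proof. by have [m ->] := lebesgue_rV_measure n; exact: measure0. Qed.

Let lebesgue_rV_ge0 n A : (0 <= lebesgue_rV n A)%E.
Proof. by have [m ->] := lebesgue_rV_measure n; exact: measure_ge0. Qed.

Let lebesgue_rV_sigma_additive n : semi_sigma_additive (lebesgue_rV n).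
Proof.
have [m ->] := lebesgue_rV_measure n; exact: measure_semi_sigma_additive.
Qed.

HB.instance Definition _ n := isMeasure.Build _ _ _ (lebesgue_rV n)
  (lebesgue_rV0 n) (@lebesgue_rV_ge0 n) (@lebesgue_rV_sigma_additive n).

End rV_lebesgue.

Section fourier.
Context {R : realType} {d : nat}.
Implicit Types (f g : 'rV[R]_d -> R[i]) (x xi : 'rV[R]_d).

Local Notation mu := (@lebesgue_rV R d).

Definition dotr x xi : R := \sum_(i < d) x 0 i * xi 0 i.

(* The norm carried by 'rV[R]_d in the library is the sup norm. *)
Definition enorm x : R := Num.sqrt (dotr x x).

(* e^{it} *)
Definition expi (t : R) : R[i] := cos t +i* sin t.

(* "f in L^1": since functions are identified when equal almost everywhere and
   mu is only defined on Borel sets, f is integrable when it agrees almost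
   everywhere with a Borel integrable function. *)
Definition L1 f : Prop := exists g,
  [/\ mu.-integrable setT (EFin \o (fun x => complex.Re (g x))),
      mu.-integrable setT (EFin \o (fun x => complex.Im (g x))) &
      {ae mu, forall x, f x = g x}].

Definition Cintegral f : R[i] :=
  (\int[mu]_x complex.Re (f x)) +i* (\int[mu]_x complex.Im (f x)).

Definition fourier f xi : R[i] := Cintegral (fun x => f x * expi (- dotr x xi)).

(* || f ||_l^sigma, for f on the whole of R^d. *)
Definition wnorm (sigma : R -> R) (l : R) f : \bar R :=
  if `[< L1 f >]
  then (\int[mu]_xi (normc (fourier f xi) * expR (l * sigma (enorm xi)))%:E)%E
  else +oo%E.

End fourier.

Section weights.
Context {R : realType}.
Implicit Types (omega : R -> R).

(* A weight is a function on [0, +oo[: the values of omega on negative reals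
   are irrelevant. *)
Record weight omega : Prop := Weight {
  weight_ge0 : forall t : R, 0 <= t -> 0 <= omega t ;
  weight_nondecreasing :
    forall s t : R, 0 <= s -> s <= t -> omega s <= omega t ;
  weight_continuous : {within `[0, +oo[, continuous omega} ;
  weight0 : omega 0 = 0 ;
  weight_subadditive :
    forall s t : R, 0 <= s -> 0 <= t -> omega (s + t) <= omega s + omega t ;
  weight_integral :
    (\int[lebesgue_measure]_(t in `[1%R, +oo[) (omega t / t ^+ 2)%:E < +oo)%E ;
  weight_log : omega t / ln (1 + t) @[t --> +oo] --> +oo
}.

Definition weight_ll omega1 omega2 : Prop :=
  forall e : R, 0 < e -> \forall t \near +oo, `|omega1 t| <= e * `|omega2 t|.

End weights.

(* A function on Omega is represented by f : 'rV[R]_d -> R[i], of which only the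
   values on Omega matter; [zext Omega f] is its extension by 0 to R^d. *)

Section test_functions.
Context {R : realType} {d : nat}.
Implicit Types (Omega K : set 'rV[R]_d) (f psi : 'rV[R]_d -> R[i]).
Implicit Types (omega sigma : R -> R).

Local Notation mu := (@lebesgue_rV R d).

Definition zext Omega f : 'rV[R]_d -> R[i] := patch (fun=> 0) Omega f.

(* The support is the one of the class of f modulo equality almost everywhere. *)
Definition compact_support_in Omega f : Prop := exists K,
  [/\ compact K, K `<=` Omega & {ae mu, forall x, (Omega `\` K) x -> f x = 0}].

(* D^{omega}(Omega) *)
Definition test_function omega Omega f : Prop :=
  compact_support_in Omega f /\
  exists2 l : R, 0 < l & (wnorm omega l (zext Omega f) < +oo)%E.

(* An element psi of D^{omega}(Omega) has an integrable Fourier transform, so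
   its class modulo equality almost everywhere has exactly one representative
   continuous on Omega; "psi = 1 on K" refers to the values of that one. *)
Definition cutoff omega Omega K psi : Prop :=
  [/\ test_function omega Omega psi,
      {within Omega, continuous (fun x => complex.Re (psi x))},
      {within Omega, continuous (fun x => complex.Im (psi x))} &
      forall x, K x -> psi x = 1].

(* || f ||_{K,l}^sigma; omega is the weight of the cutoffs, and the infimum of
   the empty set is +oo. *)
Definition local_wnorm omega Omega K (sigma : R -> R) (l : R) f : \bar R :=
  ereal_inf [set wnorm sigma l (zext Omega (fun x => psi x * f x))
            | psi in cutoff omega Omega K].

End test_functions.

(* Main.v *)
Require Import Defs.
From HB Require Import structures.
From mathcomp Require Import all_boot all_order all_algebra.
From mathcomp Require Import complex.
From mathcomp Require Import ring lra.
From mathcomp Require Import all_classical all_reals all_analysis.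
From mathcomp Require Import measurable_realfun.

Set Implicit Arguments.
Unset Strict Implicit.
Unset Printing Implicit Defensive.

Import Order.TTheory GRing.Theory Num.Theory.
Import numFieldNormedType.Exports.
Import ComplexField.Normc.

Local Open Scope classical_set_scope.
Local Open Scope complex_scope.
Local Open Scope ring_scope.

(** Test functions are described by the weights [omega'] negligible with respect
to [omega]: a nonnegative function that is integrable against [expR omega'] for
all of these is integrable against [expR (l * omega)] for some [l > 0]. Both
implications reduce to statements on a single integral by means of cutoffs.

If [psi] is a cutoff equal to [1] on a compact set that carries the support of
[phi], then [psi * phi] and [phi] are almost everywhere equal and have the same
norms ([ae_zext_mul], [ae_eq_wnorm]). For a test function [phi], the bound
[omega' <= l * omega + C] then controls all local norms ([wnorm_weight_ll]),
provided that there are cutoffs. Conversely, finite local norms give finite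
norms of [phi] for all [omega'] negligible with respect to [omega], and one has
to find [l] ([exists_wnorm_lty]). If no [l] were suitable, the integral with
exponent [omega / n.+1] would be infinite for each [n], hence would exceed [n]
already on some bounded set. Composing [omega] with a suitable concave function
[th] such that [th x = o(x)] produces one weight that is negligible with respect
to [omega] and yet above [omega / n.+1] on the [n]-th bounded set
([exists_weight_ll]), which contradicts the hypothesis.

The existence of cutoffs ([exists_cutoff]) rests on the convergence of the
integral of [omega t / t ^+ 2]. On the line, averaging a function over an
interval of length [a] multiplies its Fourier transform at [xi] by a factor of
modulus at most [2 / (a * |xi|)] and spreads its support by [a]. A sequence of
averages with finite total length can be arranged so that the Fourier transform
decays like [expR (- omega)] ([exists_average_lengths]): about
[omega (2 ^+ j)] averages over length comparable to [1 / 2 ^+ j] for each [j],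
and the sum of the [omega (2 ^+ j) / 2 ^+ j] converges ([weight_dyadic_sum]).
Averages preserve sums, so the hat functions of a fine grid turn into a
partition of unity with this decay ([exists_partition]). Its tensor powers are
partitions of unity on R^d whose Fourier transforms are products
([fourier_tensor]), controlled by subadditivity of [omega]; the cutoff is the
sum of the members that meet the given compact set. *)

(** * Integrals of functions that need not be measurable *)

Section lower_integral.
Local Open Scope ereal_scope.
Context d (T : measurableType d) (R : realType).
Variable mu : {measure set T -> \bar R}.
Implicit Types f g : T -> \bar R.
Import HBNNSimple.

Lemma integral_le_nnsfun f c : (forall x, 0 <= f x) ->
  (forall h : {nnsfun T >-> R}, (forall x, (h x)%:E <= f x) ->
    \int[mu]_x (h x)%:E <= c) ->
  \int[mu]_x f x <= c.
Proof.
move=> f0 H; rewrite ge0_integralTE//; apply/ge_ereal_sup => _ [h /= hf <-].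
have := H h hf.
by rewrite integral_nnsfun// patch_setT.
Qed.

Lemma nnsfun_le_integral f (h : {nnsfun T >-> R}) : (forall x, 0 <= f x) ->
  (forall x, (h x)%:E <= f x) -> \int[mu]_x (h x)%:E <= \int[mu]_x f x.
Proof.
move=> f0 hf; rewrite [leRHS]ge0_integralTE//; apply: ereal_sup_ubound => /=.
by exists h => //; rewrite integral_nnsfun// patch_setT.
Qed.

(** The integral of a nonnegative function is a supremum over the simple
functions below it, hence monotone on all functions. Such statements serve for
functions that are only almost everywhere equal to a Borel function. *)
Lemma ge0_le_integral_nomeas f g : (forall x, 0 <= f x) ->
  (forall x, f x <= g x) -> \int[mu]_x f x <= \int[mu]_x g x.
Proof.
move=> f0 fg; apply: integral_le_nnsfun => // h hf.
apply: nnsfun_le_integral => x; first exact: le_trans (fg x).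
exact: le_trans (fg x).
Qed.

Lemma ge0_integralZl_lty (C : R) f : (0 < C)%R -> (forall x, 0 <= f x) ->
  \int[mu]_x f x < +oo -> \int[mu]_x (C%:E * f x) < +oo.
Proof.
move=> C0 f0 fi; apply: (@le_lt_trans _ _ (C%:E * \int[mu]_x f x)); last first.
  by apply: lte_mul_pinfty => //; rewrite lee_fin ltW.
have Cf0 x : 0 <= C%:E * f x by rewrite mule_ge0// lee_fin ltW.
apply: integral_le_nnsfun => // h hf.
have Ci0 : (0 <= C^-1)%R by rewrite invr_ge0 ltW.
pose h' : {nnsfun T >-> R} := scale_nnsfun h Ci0.
have h'f x : (h' x)%:E <= f x.
  rewrite /= EFinM -[leRHS]mul1e -(mulVf (lt0r_neq0 C0)) EFinM -muleA.
  by rewrite lee_pmul2l// ?lte_fin ?invr_gt0.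
have -> : \int[mu]_x (h x)%:E = C%:E * \int[mu]_x (h' x)%:E.
  rewrite -ge0_integralZl_EFin//.
  - by apply: eq_integral => x _; rewrite /= -EFinM mulrA mulfV ?mul1r// gt_eqF.
  - by move=> x _; rewrite lee_fin.
  - exact/measurable_EFinP.
  - exact: ltW.
by rewrite lee_pmul2l// nnsfun_le_integral.
Qed.

(** A simple function below [f] may be set to [0] on a null set outside which [f]
and [g] agree: its integral is unchanged, and it is then below [g]. *)
Lemma ge0_ae_eq_integral_nomeas f g :
  (forall x, 0 <= f x) -> (forall x, 0 <= g x) ->
  {ae mu, forall x, f x = g x} -> \int[mu]_x f x = \int[mu]_x g x.
Proof.
have main f' g' : (forall x, 0 <= f' x) -> (forall x, 0 <= g' x) ->
    {ae mu, forall x, f' x = g' x} -> \int[mu]_x f' x <= \int[mu]_x g' x.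
  move=> f0 g0 [N [mN N0 fgN]]; apply: integral_le_nnsfun => // h hf.
  rewrite (@ge0_negligible_integral _ _ _ _ _ N)//; last 2 first.
    exact/measurable_EFinP.
    by move=> x _; rewrite lee_fin.
  rewrite setTD integral_mkcond; apply: ge0_le_integral_nomeas => x.
    by rewrite patchE; case: ifP => // _; rewrite lee_fin.
  rewrite patchE; case: ifPn => // /[!inE] Nx.
  by rewrite (le_trans (hf x))// (_ : f' x = g' x)//; apply: contra_notP Nx => /fgN.
move=> f0 g0 fg; apply/eqP; rewrite eq_le !main//.
by case: fg => N [? ? fgN]; exists N; split => // x /= /nesym; exact: fgN.
Qed.

Lemma ae_eq_integral_nomeas f g :
  {ae mu, forall x, f x = g x} -> \int[mu]_x f x = \int[mu]_x g x.
Proof.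
move=> fg; rewrite [LHS]integralE [RHS]integralE.
congr (_ - _); apply: ge0_ae_eq_integral_nomeas => //;
  by apply: filterS fg => x; rewrite ?funeposE ?funenegE => ->.
Qed.

(** The exhaustion is measurable, so monotone convergence may be applied to a
simple function below [f] instead of [f] itself. *)
Lemma exhaust_integral_pinfty f (D : (set T)^nat) (c : R) :
  (forall x, 0 <= f x) -> nondecreasing_seq D -> (forall n, measurable (D n)) ->
  \bigcup_n D n = setT -> \int[mu]_x f x = +oo ->
  exists n, c%:E <= \int[mu]_x (f \_ (D n)) x.
Proof.
move=> f0 ndD mD DT foo; apply: contrapT => /forallNP H.
have : \int[mu]_x f x <= c%:E; last by rewrite foo leye_eq.
apply: integral_le_nnsfun => // h hf.
have hcvg : \int[mu]_(x in D n) (h x)%:E @[n --> \oo] -->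
    \int[mu]_(x in \bigcup_n D n) (h x)%:E.
  apply: ge0_nondecreasing_set_cvg_integral => // [i|i x _].
    by apply/measurable_EFinP; exact: measurable_funTS.
  by rewrite lee_fin.
rewrite -DT; apply: (cvge_to_le hcvg).
near=> n; apply: (@le_trans _ _ (\int[mu]_x (f \_ (D n)) x)); last first.
  by apply/ltW; rewrite ltNge; exact/negP/H.
rewrite integral_mkcond; apply: ge0_le_integral_nomeas => x.
  by rewrite patchE; case: ifP => // _; rewrite lee_fin.
by rewrite !patchE; case: ifPn.
Unshelve. all: by end_near. Qed.

End lower_integral.

(** * Weights *)

Section weight_theory.
Context {R : realType}.
Implicit Types (omega : R -> R) (x y t : R).

Lemma weight_ln_le omega (w : weight omega) (A : R) :
  exists2 T : R, 0 <= T & forall t, T <= t -> A * ln (1 + t) <= omega t.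
Proof.
have /cvgryPge/(_ A)[M [_ HM]] := weight_log w.
exists (Num.max 1 (M + 1)); first by rewrite le_max ler01.
move=> t; rewrite ge_max => /andP[t1 tM].
have ln0 : 0 < ln (1 + t) by rewrite ln_gt0// ltrDl (lt_le_trans ltr01).
rewrite -ler_pdivlMr//; apply: HM; apply: lt_le_trans tM.
by rewrite ltrDl.
Qed.

Lemma weight_ge_near omega (w : weight omega) (A : R) :
  \forall t \near +oo, A <= omega t.
Proof.
have [T T0 HT] := weight_ln_le w 1.
near=> t; apply: (le_trans _ (HT t _)); last first.
  by near: t; apply: nbhs_pinfty_ge; exact: num_real.
rewrite mul1r -[leLHS]expRK ler_ln ?posrE ?expR_gt0//.
  apply: (@le_trans _ _ t); last by rewrite lerDr.
  by near: t; apply: nbhs_pinfty_ge; exact: num_real.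
rewrite ltr_pwDl// (le_trans T0)//; near: t; apply: nbhs_pinfty_ge; exact: num_real.
Unshelve. all: by end_near. Qed.

(** The values of a weight on negative numbers are arbitrary; [`|t|] avoids them,
so that [omega] becomes continuous on the whole line. *)
Lemma weight_continuous_norm omega (w : weight omega) :
  continuous (fun t : R => omega `|t|).
Proof.
move=> x.
apply: (@cvg_comp R R R (fun t => `|t|) omega (nbhs x)
  (within `[0%R, +oo[ (nbhs `|x|))).
  move=> A wA.
  have : \forall y \near x, `[0%R, +oo[%classic `|y| -> A `|y|.
    exact: (@norm_continuous R R x _ wA).
  apply: filterS => y /=; apply.
  by rewrite in_itv/= andbT normr_ge0.
rewrite nbhs_subspace_in; first exact: (weight_continuous w).
by rewrite /= in_itv/= andbT.
Qed.

Section concave_minorant.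
Variable c : nat -> R.
Hypotheses (c0 : c 0%N = 0) (c_ge0 : forall n, 0 <= c n).

(** An infimum of affine functions of slopes tending to [0], hence concave on
[0, +oo[ and negligible with respect to the identity at infinity; [`|x|] keeps it
nonnegative on the whole line. *)
Definition concave_minorant (x : R) : R :=
  inf (range (fun n : nat => `|x| / n.+1%:R + c n)).

Let th := concave_minorant.

Lemma concave_minorant_le n x : th x <= `|x| / n.+1%:R + c n.
Proof.
apply: ge_inf; last by exists n.
exists 0 => _ [m _ <-]; by rewrite addr_ge0// divr_ge0.
Qed.

Lemma concave_minorant_ge y x :
  (forall n, y <= `|x| / n.+1%:R + c n) -> y <= th x.
Proof.
move=> H; apply: lb_le_inf; first by exists (`|x| / 1%:R + c 0%N), 0%N.
by move=> _ [n _ <-].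
Qed.

Lemma concave_minorant_ge0 x : 0 <= th x.
Proof. by apply: concave_minorant_ge => n; rewrite addr_ge0// divr_ge0. Qed.

Lemma concave_minorant0 : th 0 = 0.
Proof.
apply/eqP; rewrite eq_le concave_minorant_ge0 andbT.
by rewrite (le_trans (concave_minorant_le 0 _))// normr0 mul0r add0r c0.
Qed.

Lemma concave_minorant_le_id x : th x <= `|x|.
Proof. by rewrite (le_trans (concave_minorant_le 0 _))// divr1 c0 addr0. Qed.

Lemma concave_minorant_nondecreasing x y : 0 <= x -> x <= y -> th x <= th y.
Proof.
move=> x0 xy; apply: concave_minorant_ge => n.
rewrite (le_trans (concave_minorant_le n _))// lerD2r ler_pM2r ?invr_gt0//.
by rewrite !ger0_norm// (le_trans x0).
Qed.

(** Of the two affine functions that nearly realize the infimum at [x] and [y],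
the one of smaller slope bounds the infimum at [x + y]. *)
Lemma concave_minorant_subadditive x y : 0 <= x -> 0 <= y ->
  th (x + y) <= th x + th y.
Proof.
move=> x0 y0; rewrite -lerBlDr; apply: concave_minorant_ge => n.
rewrite lerBlDl -lerBlDr; apply: concave_minorant_ge => m.
rewrite lerBlDl !ger0_norm//.
wlog nm : x y x0 y0 n m / (n <= m)%N.
  move=> H; have [|/ltnW] := leqP n m; first exact: H.
  by move=> mn; rewrite addrC [leRHS]addrC; exact: H.
rewrite (le_trans (concave_minorant_le m _))// ger0_norm ?addr_ge0// mulrDl.
have : x / m.+1%:R <= x / n.+1%:R.
  by rewrite ler_wpM2l// lef_pV2 ?posrE// ler_nat.
rewrite -addrA => xnm; rewrite lerD//.
by rewrite (le_trans xnm)// lerDl c_ge0.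
Qed.

Lemma concave_minorant_lipschitz x y : th x <= th y + `|x - y|.
Proof.
rewrite -lerBlDr; apply: concave_minorant_ge => n.
rewrite lerBlDr (le_trans (concave_minorant_le n _))//.
rewrite addrAC lerD2r (@le_trans _ _ ((`|y| + `|x - y|) / n.+1%:R))//.
  by rewrite ler_wpM2r// -{1}(subrK y x) addrC ler_normD.
by rewrite mulrDl lerD2l ler_pdivrMr// ler_peMr// ler1n.
Qed.

Lemma concave_minorant_continuous : continuous th.
Proof.
move=> x; apply/cvgrPdist_lt => e e0; near=> y.
apply: (@le_lt_trans _ _ `|x - y|).
  have := concave_minorant_lipschitz x y; have := concave_minorant_lipschitz y x.
  rewrite distrC ler_norml; set a := `|_|; rewrite /th => ? ?.
  by apply/andP; split; lra.
by near: y; apply: cvgr_dist_lt.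
Unshelve. all: by end_near. Qed.

End concave_minorant.

(** The comparison weight is [th \o omega], where [th] is a concave minorant of
the identity: concavity preserves subadditivity, and the intercepts [c n] can
be taken as large as needed to keep [th x] above [x / n.+1] up to [s n], and to
keep [th \o omega] above every multiple of [ln]. *)
Lemma exists_weight_ll omega (w : weight omega) (s : nat -> R) :
  exists omega', [/\ weight omega', weight_ll omega' omega &
    forall n t, 0 <= t -> omega t <= s n -> omega t / n.+1%:R <= omega' t].
Proof.
(* The square leaves a factor [n.+1] once [omega] has been divided by [n.+1]. *)
have [T HT] := choice (fun n : nat =>
  let: ex_intro2 T T0 H := weight_ln_le w (n.+1%:R ^+ 2) in
  ex_intro (fun T => 0 <= T /\ forall t, T <= t ->
    n.+1%:R ^+ 2 * ln (1 + t) <= omega t) T (conj T0 H)).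
have T0 n : 0 <= T n by have [] := HT n.
have {}HT n t : T n <= t -> n.+1%:R ^+ 2 * ln (1 + t) <= omega t.
  by have [_] := HT n; apply.
have wT0 n : 0 <= omega (T n) by exact: (weight_ge0 w).
pose u j := `|s j| + omega (T j).
have u0 j : 0 <= u j by rewrite addr_ge0.
(* [c 0 = 0] makes the minorant vanish at [0]. The other intercepts exceed all
   thresholds met so far. *)
pose c n := if n is 0%N then 0 else \sum_(j < n.+1) u j.
have c_ge0 n : 0 <= c n by case: n => //= n; exact: sumr_ge0.
have uc j k : (j <= k)%N -> (0 < k)%N -> u j <= c k.
  case: k => // k jk _; rewrite /c (bigD1 (Ordinal (jk : (j < k.+2)%N)))//=.
  by rewrite lerDl sumr_ge0.
have c0 : c 0%N = 0 by [].
have w0 t : 0 <= t -> 0 <= omega t by exact: (weight_ge0 w).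
exists (concave_minorant c \o omega); split; last first.
- move=> n t t0 tn; apply: concave_minorant_ge => // k.
  rewrite (ger0_norm (w0 _ t0)).
  have [kn|nk] := leqP k n.
    rewrite -[leLHS]addr0 lerD// ler_wpM2l ?w0// lef_pV2 ?posrE//.
    by rewrite ler_nat.
  have := uc _ _ (ltnW nk) (leq_ltn_trans (leq0n n) nk).
  have : omega t / n.+1%:R <= omega t.
    by rewrite ler_pdivrMr// ler_peMr ?w0// ler1n.
  have : 0 <= omega t / k.+1%:R by rewrite divr_ge0// w0.
  have := ler_norm (s n); have := wT0 n; rewrite /u.
  by move: (omega t / n.+1%:R) (omega t / k.+1%:R) => p q; lra.
- move=> e e0.
  have e20 : 0 < e / 2 by rewrite divr_gt0.
  pose n := Num.truncn (e / 2)^-1.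
  have ne : n.+1%:R^-1 <= e / 2.
    rewrite invf_ple ?posrE//.
    by rewrite ltW// truncnS_gt.
  near=> t.
  have t0 : 0 <= t by near: t; apply: nbhs_pinfty_ge; exact: num_real.
  rewrite /= (ger0_norm (concave_minorant_ge0 _ _))// (ger0_norm (w0 _ t0)).
  rewrite (le_trans (concave_minorant_le _ n _))// (ger0_norm (w0 _ t0)).
  have : omega t / n.+1%:R <= e / 2 * omega t by rewrite mulrC ler_wpM2r// w0.
  suff : c n <= e / 2 * omega t by move: (omega t / n.+1%:R) => p; lra.
  rewrite mulrC -ler_pdivrMr//; near: t.
  exact: weight_ge_near.
- split => /=.
  + by move=> t t0; exact: concave_minorant_ge0.
  + move=> x y x0 xy; apply: concave_minorant_nondecreasing => //; first exact: w0.
    exact: (weight_nondecreasing w).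
  + apply: within_continuous_comp; last exact: (weight_continuous w).
    by move=> x _; exact: concave_minorant_continuous.
  + by rewrite (weight0 w) concave_minorant0.
  + move=> x y x0 y0; apply: le_trans (concave_minorant_subadditive c_ge0 _ _) => //.
    * apply: concave_minorant_nondecreasing => //; first by rewrite w0// addr_ge0.
      exact: (weight_subadditive w).
    * exact: w0.
    * exact: w0.
  + apply: le_lt_trans (weight_integral w).
    rewrite integral_mkcond [leRHS]integral_mkcond.
    apply: ge0_le_integral_nomeas => t; rewrite !patchE; case: ifPn => //.
      by move=> _; rewrite lee_fin divr_ge0 ?sqr_ge0// concave_minorant_ge0.
    rewrite inE/= in_itv/= andbT => t1; rewrite lee_fin ler_wpM2r ?invr_ge0 ?sqr_ge0//.
    rewrite -[leRHS]ger0_norm ?concave_minorant_le_id//.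
    by rewrite w0// (le_trans ler01).
  + apply/cvgryPge => A; pose N := Num.truncn `|A|.
    have AN : A <= N.+1%:R by rewrite (le_trans (ler_norm _))// ltW// truncnS_gt.
    near=> t.
    have t0 : 0 < t by near: t; apply: nbhs_pinfty_gt; exact: num_real.
    have tN : T N <= t by near: t; apply: nbhs_pinfty_ge; exact: num_real.
    have L0 : 0 < ln (1 + t) by rewrite ln_gt0// ltrDl.
    rewrite ler_pdivlMr// (le_trans (ler_wpM2r (ltW L0) AN))//.
    apply: concave_minorant_ge => // k; rewrite ger0_norm ?w0// ?(ltW t0)//.
    have key m : (N <= m)%N -> T m <= t -> forall i, (i <= m)%N ->
        N.+1%:R * ln (1 + t) <= omega t / i.+1%:R.
      move=> Nm Tm i im; have := HT m t Tm.
      rewrite ler_pdivlMr//; apply: le_trans.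
      rewrite mulrAC ler_wpM2r ?(ltW L0)// expr2.
      by rewrite ler_pM// ler_nat ltnS.
    (* The [k]-th affine function is large by its slope when [k <= N] or
       [T k <= t], and by its intercept otherwise. *)
    have [kN|Nk] := leqP k N.
      by rewrite -[leLHS]addr0 lerD// (key N).
    have [Tk|Tk] := leP (T k) t.
      by rewrite -[leLHS]addr0 lerD// (key k)// ltnW.
    have := key N (leqnn _) tN 0%N (leq0n _); rewrite divr1.
    have := weight_nondecreasing w (ltW t0) (ltW Tk).
    have := uc _ _ (leqnn k) (leq_ltn_trans (leq0n N) Nk).
    have : 0 <= omega t / k.+1%:R by rewrite divr_ge0// w0// ltW.
    have := normr_ge0 (s k); rewrite /u.
    by move: (omega t / k.+1%:R) (N.+1%:R * _) => p q; lra.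
Unshelve. all: by end_near. Qed.

End weight_theory.

(** * Repeated averaging of functions of one variable *)

Section one_variable_calculus.
Context {R : realType}.
Local Notation mu := (@lebesgue_measure R).
Implicit Types (f g h F : R -> R) (a b c p q x y t s N L : R).

Lemma continuous_itv_integrable f a b : continuous f ->
  mu.-integrable `[a, b] (EFin \o f).
Proof.
move=> cf; apply: continuous_compact_integrable; first exact: segment_compact.
exact: continuous_subspaceT.
Qed.

Lemma is_derive_continuous F f x : is_derive x 1 F (f x) -> {for x, continuous F}.
Proof. by move=> dF; apply/differentiable_continuous/derivable1_diffP. Qed.

Lemma Rintegral_FTC2 F f a b : a < b -> continuous f ->
  (forall y, is_derive y 1 F (f y)) ->
  \int[mu]_(t in `[a, b]) f t = F b - F a.
Proof.
move=> ab cf dF.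
have cF x : {for x, continuous F} by exact: is_derive_continuous (dF x).
rewrite /Rintegral (@continuous_FTC2 _ f F)//.
- exact: continuous_subspaceT.
- split; first by move=> x _; have [] := dF x.
  + by apply: cvg_at_right_filter; exact: cF.
  + by apply: cvg_at_left_filter; exact: cF.
- by move=> x _; rewrite derive1E; have [] := dF x.
Qed.

Lemma exists_antiderivative f p : continuous f -> (forall x, x <= p -> f x = 0) ->
  exists F, forall y, is_derive y 1 F (f y).
Proof.
move=> cf f0.
pose F c := fun y => \int[mu]_(t in [set` `[c, y]]) f t.
(* Any base point to the left of [p] gives the same primitive, so at each [y]
   a base point to the left of [y] may be used. *)
have FE c : c <= p -> F c = F p.
  move=> cp; apply/funext => y; rewrite /F Rintegral_mkcond [RHS]Rintegral_mkcond.
  congr (Rintegral _ _ _); apply/funext => t; rewrite !patchE !mem_setE !in_itv/=.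
  have [pt|/ltW /f0 ->] := leP p t; last by rewrite !if_same.
  by rewrite (le_trans cp pt).
exists (F p) => y.
pose c := Num.min p (y - 1).
have cy : c < y by rewrite gt_min ltrBlDr ltrDl ltr01 orbT.
rewrite -(FE c) ?ge_min ?lexx//.
have [dF Fy] := @continuous_FTC1_closed R f c y (y + 1)
  (ltr_pwDr ltr01 (lexx _)) (continuous_itv_integrable _ _ cf) cy (cf y).
by apply: DeriveDef; [exact: dF|rewrite -derive1E Fy].
Qed.

(** Both sides are increments of one primitive of [f]. *)
Lemma Rintegral_shift f p a b c : a < b -> continuous f ->
  (forall x, x <= p -> f x = 0) ->
  \int[mu]_(t in `[a, b]) f (t + c) = \int[mu]_(t in `[a + c, b + c]) f t.
Proof.
move=> ab cf f0; have [F dF] := exists_antiderivative cf f0.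
rewrite [RHS](Rintegral_FTC2 (F := F))// ?ltrD2r//.
apply: (@Rintegral_FTC2 (fun t => F (t + c)) (fun t => f (t + c))) => //.
  move=> x; apply: (@continuous_comp _ _ _ (fun t => t + c) f); last exact: cf.
  by apply: continuousD; [exact: cvg_id|exact: cvg_cst].
move=> y; rewrite -[f _]mulr1.
apply: (is_derive1_comp (f := F) (g := fun t => t + c)).
by rewrite -[X in is_derive _ _ _ X]addr0; exact: is_deriveD.
Qed.

Lemma Rintegral_eq0 f a b : (forall x, a <= x <= b -> f x = 0) ->
  \int[mu]_(t in `[a, b]) f t = 0.
Proof.
move=> f0; rewrite (@eq_Rintegral _ _ _ _ _ (cst 0)); last first.
  by move=> x; rewrite inE/= in_itv/= => /f0.
by rewrite Rintegral_cst// mul0r.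
Qed.

Lemma Rintegral_shift_supp f p q a b c : 0 < c -> a + c <= p -> p < q -> q <= b ->
  continuous f ->
  (forall x, x <= p -> f x = 0) -> (forall x, q <= x -> f x = 0) ->
  \int[mu]_(t in `[a, b]) f (t + c) = \int[mu]_(t in `[a, b]) f t.
Proof.
move=> c0 ap pq qb cf fp fq.
have ac : a < a + c by rewrite ltrDl.
have bc : b < b + c by rewrite ltrDl.
have ab : a < b by rewrite (lt_le_trans ac)// (le_trans ap)// (le_trans (ltW pq)).
rewrite (Rintegral_shift c ab cf fp).
have [F dF] := exists_antiderivative cf fp.
rewrite !(Rintegral_FTC2 (F := F))// ?ltrD2r//.
have : F (b + c) - F b = 0.
  rewrite -(Rintegral_FTC2 (f := f))//; apply: Rintegral_eq0 => x /andP[bx _].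
  by rewrite fq// (le_trans qb).
have : F (a + c) - F a = 0.
  rewrite -(Rintegral_FTC2 (f := f))//; apply: Rintegral_eq0 => x /andP[_ xa].
  by rewrite fp// (le_trans xa).
lra.
Qed.

Definition is_lipschitz L f := forall x y, `|f x - f y| <= L * `|x - y|.

Lemma is_lipschitz_continuous L f : is_lipschitz L f -> continuous f.
Proof.
move=> lf x; apply/cvgrPdist_lt => e e0.
have L1 : 0 < `|L| + 1 by rewrite ltr_pwDr.
near=> y; apply: (le_lt_trans (lf x y)).
apply: (@le_lt_trans _ _ ((`|L| + 1) * `|x - y|)).
  by rewrite ler_wpM2r// (le_trans (ler_norm _))// lerDl.
rewrite mulrC -ltr_pdivlMr//; near: y.
by apply: cvgr_dist_lt => //; rewrite divr_gt0.
Unshelve. all: by end_near. Qed.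

Definition average a f x := a^-1 * \int[mu]_(t in `[0, a]) f (x + t).

Lemma continuous_shift f x : continuous f -> continuous (fun t => f (x + t)).
Proof.
move=> cf t; apply: (@continuous_comp _ _ _ (fun t => x + t) f); last exact: cf.
by apply: continuousD; [exact: cvg_cst|exact: cvg_id].
Qed.

Lemma continuous_shiftr f x : continuous f -> continuous (fun t => f (t + x)).
Proof.
move=> cf; rewrite (_ : (fun t => _) = (fun t => f (x + t))); last first.
  by apply/funext => t; rewrite addrC.
exact: continuous_shift.
Qed.

Lemma continuous_cstM f c : continuous f -> continuous (fun t => c * f t).
Proof.
move=> cf x; apply: (@continuousM _ _ (fun=> c) f); last exact: cf.
exact: cvg_cst.
Qed.

Lemma average_cst a c x : 0 < a -> average a (cst c) x = c.
Proof.
move=> a0; rewrite /average Rintegral_cst//= lebesgue_measure_itv/= lte_fin a0.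
by rewrite -EFinD/= subr0 mulrC mulfK// gt_eqF.
Qed.

Lemma averageD a f g x : 0 < a -> continuous f -> continuous g ->
  average a (f \+ g) x = average a f x + average a g x.
Proof.
move=> a0 cf cg; rewrite /average -mulrDr; congr *%R.
by rewrite RintegralD//; apply: continuous_itv_integrable; exact: continuous_shift.
Qed.

Lemma le_average a f g x y : 0 < a -> continuous f -> continuous g ->
  (forall t, 0 <= t <= a -> f (x + t) <= g (y + t)) -> average a f x <= average a g y.
Proof.
move=> a0 cf cg fg; rewrite /average ler_pM2l ?invr_gt0//.
apply: le_Rintegral => //.
- by apply: continuous_itv_integrable; exact: continuous_shift.
- by apply: continuous_itv_integrable; exact: continuous_shift.
Qed.

Lemma le_averageD a f g x y c : 0 < a -> continuous f -> continuous g ->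
  (forall t, 0 <= t <= a -> f (x + t) <= g (y + t) + c) ->
  average a f x <= average a g y + c.
Proof.
move=> a0 cf cg fg; rewrite -{1}(average_cst c y a0) -averageD//;
  last by move=> ?; exact: cvg_cst.
apply: le_average => // z; apply: continuousD; [exact: cg|exact: cvg_cst].
Qed.

Lemma is_lipschitz_average a L f : 0 < a -> is_lipschitz L f ->
  is_lipschitz L (average a f).
Proof.
move=> a0 lf; have cf := is_lipschitz_continuous lf.
suff H x y : average a f x <= average a f y + L * `|x - y|.
  move=> x y; have := H x y; have := H y x; rewrite (distrC y x) ler_norml.
  by move: (L * _) => k ? ?; apply/andP; split; lra.
apply: le_averageD => // t _; rewrite -lerBlDl (le_trans (ler_norm _))//.
by rewrite (le_trans (lf _ _))// opprD addrACA subrr addr0.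
Qed.

Lemma average_itv_cst a f x c : 0 < a -> continuous f ->
  (forall y, x <= y <= x + a -> f y = c) -> average a f x = c.
Proof.
move=> a0 cf fc; rewrite -[RHS](average_cst c x a0) /average.
congr *%R; apply: eq_Rintegral => t; rewrite inE/= in_itv/= => /andP[t0 ta].
by rewrite fc// lerDl t0 lerD2l.
Qed.

Lemma dist_average a L f x : 0 < a -> is_lipschitz L f -> 0 <= L ->
  `|average a f x - f x| <= L * a.
Proof.
move=> a0 lf L0; have cf := is_lipschitz_continuous lf.
have Lt t : 0 <= t <= a -> `|f (x + t) - f x| <= L * a.
  move=> /andP[t0 ta]; apply: le_trans (lf _ _) _.
  by rewrite addrAC subrr add0r ler_wpM2l// ger0_norm.
have ccst : continuous (cst (f x) : R -> R) by move=> ?; exact: cvg_cst.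
have h1 : average a f x <= f x + L * a.
  rewrite -[X in _ <= X + _](average_cst (f x) x a0); apply: (le_averageD a0) => // t.
  by move=> /Lt; rewrite ler_norml => /andP[_]; rewrite lerBlDl.
have h2 : f x <= average a f x + L * a.
  rewrite -[leLHS](average_cst (f x) x a0); apply: (le_averageD a0) => // t.
  by move=> /Lt; rewrite ler_norml => /andP[+ _]; rewrite /cst; lra.
by rewrite ler_norml; apply/andP; split; lra.
Qed.

(** Integration over [-N, N] stands for integration over the line of functions
vanishing outside [-N, N]. *)
Definition cosint N f s := \int[mu]_(t in `[- N, N]) (f t * cos (s * t)).
Definition sinint N f s := \int[mu]_(t in `[- N, N]) (f t * sin (s * t)).

Lemma continuous_cosM s : continuous (fun t => cos (s * t)).
Proof.
move=> t; apply: (@continuous_comp _ _ _ (fun t => s * t) cos).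
  by apply: continuousM; [exact: cvg_cst|exact: cvg_id].
exact: continuous_cos.
Qed.

Lemma continuous_sinM s : continuous (fun t => sin (s * t)).
Proof.
move=> t; apply: (@continuous_comp _ _ _ (fun t => s * t) sin).
  by apply: continuousM; [exact: cvg_cst|exact: cvg_id].
exact: continuous_sin.
Qed.

Lemma is_derive_sinM s x : s != 0 ->
  is_derive x 1 (fun t => s^-1 * sin (s * t)) (cos (s * x)).
Proof.
move=> s0; rewrite -[X in is_derive _ _ _ X](mulKf s0).
have -> : s^-1 * (s * cos (s * x)) = s^-1 *: (cos (s * x) * s) by rewrite (mulrC s).
apply: is_deriveZ; apply: (is_derive1_comp (f := sin) (g := fun t => s * t)).
rewrite -[X in is_derive _ _ _ X]mulr1; exact: is_deriveZ.
Qed.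

Lemma is_derive_cosM s x : s != 0 ->
  is_derive x 1 (fun t => - s^-1 * cos (s * t)) (sin (s * x)).
Proof.
move=> s0; rewrite -[X in is_derive _ _ _ X](mulKf s0).
have -> : s^-1 * (s * sin (s * x)) = (- s^-1) *: (- sin (s * x) * s).
  by rewrite /GRing.scale/= !mulNr mulrN opprK (mulrC s).
apply: is_deriveZ; apply: (is_derive1_comp (f := cos) (g := fun t => s * t)).
rewrite -[X in is_derive _ _ _ X]mulr1; exact: is_deriveZ.
Qed.

Section average_step.
Variables (a p q N : R) (f : R -> R).
Hypotheses (a0 : 0 < a) (pq : p < q) (Np : - N < p - a) (qN : q < N).
Hypotheses (cf : continuous f).
Hypotheses (fp : forall x, x <= p -> f x = 0) (fq : forall x, q <= x -> f x = 0).

Lemma average_eq0l x : x <= p - a -> average a f x = 0.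
Proof.
move=> xp; apply: average_itv_cst => // y /andP[_ ya]; apply: fp.
by rewrite (le_trans ya)// -lerBrDr.
Qed.

Lemma average_eq0r x : q <= x -> average a f x = 0.
Proof.
move=> xq; apply: average_itv_cst => // y /andP[ya _]; apply: fq.
exact: le_trans ya.
Qed.

Lemma is_derive_average x :
  is_derive x 1 (average a f) (a^-1 * (f (x + a) - f x)).
Proof.
have [F dF] := exists_antiderivative cf fp.
have -> : average a f = fun x => a^-1 *: (F (x + a) - F x).
  apply/funext => y; rewrite /average; congr *%R.
  transitivity (F (y + a) - F (y + 0)); last by rewrite addr0.
  apply: (@Rintegral_FTC2 (fun t => F (y + t)) (fun t => f (y + t))) => //.
    exact: continuous_shift.
  move=> t; rewrite -[f _]mulr1.
  apply: (is_derive1_comp (f := F) (g := fun t => y + t)).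
  by rewrite -[X in is_derive _ _ _ X]add0r; exact: is_deriveD.
apply: is_deriveZ; apply: is_deriveB.
rewrite -[f _]mulr1.
apply: (is_derive1_comp (f := F) (g := fun t => t + a)).
by rewrite -[X in is_derive _ _ _ X]addr0; exact: is_deriveD.
Qed.

Let NN : - N < N.
Proof. by apply: lt_trans Np _; rewrite ltrBlDr (lt_trans pq)// ltr_wpDr// ltW. Qed.

Let continuous_diffquot : continuous (fun x => a^-1 * (f (x + a) - f x)).
Proof.
move=> x; apply: (@continuousM _ _ (fun=> a^-1) (fun x => f (x + a) - f x)).
  exact: cvg_cst.
apply: (@continuousB _ _ _ (fun x => f (x + a)) f); last exact: cf.
exact: continuous_shiftr.
Qed.

(** The average has derivative [a^-1 * (f (x + a) - f x)]: integration by parts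
moves this difference onto [G], after a translation of the variable. *)
Lemma average_by_parts (G g : R -> R) : continuous g ->
  (forall y, is_derive y 1 G (g y)) ->
  \int[mu]_(t in `[- N, N]) (average a f t * g t) =
  a^-1 * (\int[mu]_(t in `[- N, N]) (f t * (G t - G (t - a)))).
Proof.
move=> cg dG.
have cG x : {for x, continuous G} by exact: is_derive_continuous (dG x).
have dA := is_derive_average.
have cA x : {for x, continuous (average a f)}.
  apply: (is_derive_continuous (f := fun x => a^-1 * (f (x + a) - f x))).
have cGa : continuous (fun t => G (t - a)).
  by exact: continuous_shiftr.
rewrite (@Rintegration_by_parts R (average a f) G
  (fun x => a^-1 * (f (x + a) - f x)) g)//; first last.
- by move=> x _; rewrite derive1E; have [] := dG x.
- split; first by move=> x _; have [] := dG x.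
  + by apply: cvg_at_right_filter; exact: cG.
  + by apply: cvg_at_left_filter; exact: cG.
- exact: continuous_subspaceT.
- by move=> x _; rewrite derive1E; have [] := dA x.
- split; first by move=> x _; have [] := dA x.
  + by apply: cvg_at_right_filter; exact: cA.
  + by apply: cvg_at_left_filter; exact: cA.
- exact: continuous_subspaceT.
rewrite average_eq0r ?(ltW qN)// average_eq0l ?(ltW Np)// !mul0r subr0 add0r.
have cfG : continuous (fun t => f t * G t).
  by move=> x; apply: continuousM; [exact: cf|exact: cG].
have cfGa : continuous (fun t => f t * G (t - a)).
  by move=> x; apply: continuousM; [exact: cf|exact: cGa].
have cfaG : continuous (fun t => f (t + a) * G (t + a - a)).
  move=> x; apply: (@continuousM _ _ (fun t => f (t + a)) (fun t => G (t + a - a))).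
    exact: continuous_shiftr.
  exact: (continuous_shiftr (f := fun t => G (t - a))).
transitivity (- (a^-1 * (\int[mu]_(t in `[- N, N]) (f (t + a) * G (t + a - a)) -
    \int[mu]_(t in `[- N, N]) (f t * G t)))).
  congr (- _); rewrite -RintegralB//; [|exact: continuous_itv_integrable..].
  rewrite -RintegralZl//; last first.
    apply: continuous_itv_integrable => x.
    apply: (@continuousB _ _ _ (fun t => f (t + a) * G (t + a - a))
      (fun t => f t * G t)); [exact: cfaG|exact: cfG].
  by apply: eq_Rintegral => t _; rewrite addrK; ring.
rewrite -mulrN opprB; congr *%R.
rewrite (@Rintegral_shift_supp (fun t => f t * G (t - a)) p q)//; first last.
- by move=> x /fq ->; rewrite mul0r.
- by move=> x /fp ->; rewrite mul0r.
- exact: ltW.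
- by rewrite -lerBrDr ltW.
rewrite -RintegralB//; [|exact: continuous_itv_integrable..].
by apply: eq_Rintegral => t _; rewrite mulrBr.
Qed.

End average_step.

End one_variable_calculus.

Section averages.
Context {R : realType}.
Local Notation mu := (@lebesgue_measure R).
Implicit Types (f g h : R -> R) (a b c p q x y t N L xi : R) (s : seq R).

(** Squared modulus of the Fourier transform of a function that vanishes outside
[-N, N]. *)
Definition fourier_sq N f xi := cosint N f xi ^+ 2 + sinint N f xi ^+ 2.

(** Averaging multiplies the Fourier transform by (e^{i a xi} - 1) / (i a xi),
whose squared modulus is the last factor. *)
Lemma fourier_sq_average a p q N f xi : 0 < a -> p < q -> - N < p - a -> q < N ->
  continuous f -> (forall x, x <= p -> f x = 0) -> (forall x, q <= x -> f x = 0) ->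
  xi != 0 -> fourier_sq N (average a f) xi =
  fourier_sq N f xi * ((2 - 2 * cos (xi * a)) / (xi * a) ^+ 2).
Proof.
move=> a0 pq Np qN cf fp fq x0.
have cc : continuous (fun t => cos (xi * t)).
  exact: continuous_cosM.
have cs : continuous (fun t => sin (xi * t)).
  exact: continuous_sinM.
have cfc : continuous (fun t => f t * cos (xi * t)).
  by move=> t; apply: continuousM; [exact: cf|exact: cc].
have cfs : continuous (fun t => f t * sin (xi * t)).
  by move=> t; apply: continuousM; [exact: cf|exact: cs].
have lin u v : \int[mu]_(t in `[- N, N]) (f t * (u * cos (xi * t) + v * sin (xi * t)))
    = u * cosint N f xi + v * sinint N f xi.
  rewrite /cosint /sinint -!RintegralZl//; [|exact: continuous_itv_integrable..].
  rewrite -RintegralD//.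
  - by apply: eq_Rintegral => t _; ring.
  - by apply: continuous_itv_integrable; exact: continuous_cstM.
  - by apply: continuous_itv_integrable; exact: continuous_cstM.
have hC : cosint N (average a f) xi = (xi * a)^-1 *
    (sin (xi * a) * cosint N f xi + (1 - cos (xi * a)) * sinint N f xi).
  rewrite {1}/cosint (average_by_parts a0 pq Np qN cf fp fq cc
    (fun y => is_derive_sinM y x0)).
  rewrite invfM (mulrC xi^-1) -mulrA; congr *%R.
  rewrite -lin -RintegralZl//; last first.
    apply: continuous_itv_integrable => t.
    apply: (@continuousM _ _ f); first exact: cf.
    apply: (@continuousD _ _ _ (fun t => _ * cos (xi * t)) (fun t => _ * sin (xi * t))).
      exact: continuous_cstM.
    exact: continuous_cstM.
  by apply: eq_Rintegral => t _; rewrite (mulrBr xi) sinB; ring.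
have hS : sinint N (average a f) xi = (xi * a)^-1 *
    ((cos (xi * a) - 1) * cosint N f xi + sin (xi * a) * sinint N f xi).
  rewrite {1}/sinint (average_by_parts a0 pq Np qN cf fp fq cs
    (fun y => is_derive_cosM y x0)).
  rewrite invfM (mulrC xi^-1) -mulrA; congr *%R.
  rewrite -lin -RintegralZl//; last first.
    apply: continuous_itv_integrable => t.
    apply: (@continuousM _ _ f); first exact: cf.
    apply: (@continuousD _ _ _ (fun t => _ * cos (xi * t)) (fun t => _ * sin (xi * t))).
      exact: continuous_cstM.
    exact: continuous_cstM.
  by apply: eq_Rintegral => t _; rewrite (mulrBr xi) cosB; ring.
rewrite /fourier_sq hC hS -exprVn.
have := sin2cos2 (xi * a).
move: (cosint N f xi) (sinint N f xi) (sin _) (cos _) (_^-1) => C S u v w uv.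
rewrite !exprMn -mulrDr mulrA [RHS]mulrC; congr *%R.
transitivity ((u ^+ 2 + (1 - v) ^+ 2) * (C ^+ 2 + S ^+ 2)); first by ring.
rewrite uv; ring.
Qed.

Lemma norm_sin_le x : `|sin x| <= `|x|.
Proof.
wlog x0 : x / 0 <= x.
  move=> H; have [/H//|/ltW x0] := leP 0 x.
  by have := H (- x); rewrite sinN !normrN oppr_ge0 => ->.
have [c _] := @MVT_segment R sin cos 0 x x0 (fun y _ => is_derive_sin y)
  (continuous_subspaceT (@continuous_sin R)).
rewrite sin0 !subr0 => ->; rewrite normrM ler_piMl//.
by rewrite ler_norml cos_geN1 cos_le1.
Qed.

Lemma chord_sqE x : 2 - 2 * cos x = 4 * sin (x / 2) ^+ 2.
Proof.
have := cos_mulr2n (x / 2); rewrite -[(x / 2) *+ 2]mulr_natr mulfVK// => ->.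
by rewrite sin2cos2; ring.
Qed.

Lemma chord_sq_le x : x != 0 ->
  (2 - 2 * cos x) / x ^+ 2 <= Num.min 1 (4 / x ^+ 2).
Proof.
move=> x0; have x20 : 0 < x ^+ 2 by rewrite exprn_even_gt0.
rewrite le_min chord_sqE; apply/andP; split.
  rewrite ler_pdivrMr// mul1r -(real_normK (num_real x)) -(real_normK (num_real (sin _))).
  have := norm_sin_le (x / 2); rewrite normrM (ger0_norm (_ : 0 <= 2^-1))//.
  have := normr_ge0 (sin (x / 2)); have := normr_ge0 x.
  by move: `|x| `|sin _| => u v; nra.
by rewrite ler_pM2r ?invr_gt0// ler_piMr// -(real_normK (num_real _)) expr_le1// sin_max.
Qed.

Definition averages s f := foldl (fun g a => average a g) f s.

Definition supported p q f := forall x, x <= p \/ q <= x -> f x = 0.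

Lemma averages_cat s1 s2 f : averages (s1 ++ s2) f = averages s2 (averages s1 f).
Proof. exact: foldl_cat. Qed.

Lemma is_lipschitz_averages s L f : (forall a, a \in s -> 0 < a) -> is_lipschitz L f ->
  is_lipschitz L (averages s f).
Proof.
elim: s f => [//|a s ih] f s0 lf /=; apply: ih => [b bs|].
  by apply: s0; rewrite inE bs orbT.
by apply: is_lipschitz_average => //; apply: s0; rewrite mem_head.
Qed.

(** Each average over length [a] looks at most [a] to the right, so iterated
averages at [x] only depend on the values on an interval whose length is the sum
of the lengths. *)
Lemma averages_itv_cst s L f x c : (forall a, a \in s -> 0 < a) -> is_lipschitz L f ->
  (forall y, x <= y <= x + \sum_(a <- s) a -> f y = c) -> averages s f x = c.
Proof.
elim: s f => [|a s ih] f s0 lf fc /=.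
  by apply: fc; rewrite big_nil addr0 lexx.
have a0 : 0 < a by apply: s0; rewrite mem_head.
have {}s0 b : b \in s -> 0 < b by move=> bs; apply: s0; rewrite inE bs orbT.
apply: ih => //; first exact: is_lipschitz_average.
move=> y /andP[xy yx]; apply: average_itv_cst => //.
  exact: is_lipschitz_continuous lf.
move=> z /andP[yz zy]; apply: fc; rewrite (le_trans xy)//= big_cons.
by rewrite (le_trans zy)// [leRHS]addrCA (addrC y) lerD2l.
Qed.

Lemma averagesD s L L' f g x : (forall a, a \in s -> 0 < a) ->
  is_lipschitz L f -> is_lipschitz L' g ->
  averages s (f \+ g) x = averages s f x + averages s g x.
Proof.
elim: s f g => [//|a s ih] f g s0 lf lg /=.
have a0 : 0 < a by apply: s0; rewrite mem_head.
have {}s0 b : b \in s -> 0 < b by move=> bs; apply: s0; rewrite inE bs orbT.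
rewrite -ih//; [|exact: is_lipschitz_average..].
congr (averages s _ x); apply/funext => y.
by apply: averageD => //;
  [exact: is_lipschitz_continuous lf|exact: is_lipschitz_continuous lg].
Qed.

Lemma dist_averages s L f x : (forall a, a \in s -> 0 < a) ->
  0 <= L -> is_lipschitz L f ->
  `|averages s f x - f x| <= L * \sum_(a <- s) a.
Proof.
elim: s f => [|a s ih] f s0 L0 lf /=.
  by rewrite subrr normr0 big_nil mulr0.
have a0 : 0 < a by apply: s0; rewrite mem_head.
have {}s0 b : b \in s -> 0 < b by move=> bs; apply: s0; rewrite inE bs orbT.
rewrite big_cons mulrDr [leRHS]addrC (le_trans (ler_distD (average a f x) _ (f x)))// lerD//.
  by apply: ih => //; exact: is_lipschitz_average.
exact: dist_average.
Qed.

Lemma fourier_sq_ge0 N f xi : 0 <= fourier_sq N f xi.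
Proof. by rewrite addr_ge0// sqr_ge0. Qed.

Lemma fourier_sq_averages s L p q N f xi : (forall a, a \in s -> 0 < a) ->
  is_lipschitz L f -> supported p q f -> p < q -> - N < p - \sum_(a <- s) a -> q < N ->
  xi != 0 ->
  fourier_sq N (averages s f) xi <=
  fourier_sq N f xi * \prod_(a <- s) Num.min 1 (4 / (xi * a) ^+ 2).
Proof.
elim: s p f => [|a s ih] p f s0 lf fpq pq Np qN xi0 /=.
  by rewrite big_nil mulr1.
have a0 : 0 < a by apply: s0; rewrite mem_head.
have {}s0 b : b \in s -> 0 < b by move=> bs; apply: s0; rewrite inE bs orbT.
have sum0 : 0 <= \sum_(b <- s) b.
  by rewrite big_seq sumr_ge0// => b /s0 /ltW.
rewrite big_cons in Np.
have f1 x : x <= p -> f x = 0 by move=> ?; apply: fpq; left.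
have f2 x : q <= x -> f x = 0 by move=> ?; apply: fpq; right.
have cf := is_lipschitz_continuous lf.
rewrite (le_trans (ih (p - a) _ _ _ _ _ _ _ _))//.
- exact: is_lipschitz_average.
- by move=> x [xp|xq]; [exact: average_eq0l f1 _ _|exact: average_eq0r f2 _ _].
- by rewrite (lt_trans _ pq)// gtrBl.
- by rewrite -addrA -opprD.
have Npa : - N < p - a by rewrite (lt_le_trans Np)// lerD2l lerN2 lerDl.
rewrite big_cons mulrA ler_wpM2r//.
  by apply: prodr_ge0 => b _; rewrite le_min ler01 divr_ge0// sqr_ge0.
rewrite (fourier_sq_average a0 pq Npa qN)// ler_wpM2l ?fourier_sq_ge0//.
by apply: chord_sq_le; rewrite mulf_neq0// gt_eqF.
Qed.

Lemma norm_itv_Rintegral_le f N c : 0 <= N -> continuous f ->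
  (forall t, - N <= t <= N -> `|f t| <= c) ->
  `|\int[mu]_(t in `[- N, N]) f t| <= c * (N *+ 2).
Proof.
move=> N0 cf fc.
have if_ := continuous_itv_integrable (- N) N cf.
rewrite (le_trans (le_normr_Rintegral _ if_))//.
have -> : c * (N *+ 2) = \int[mu]_(t in `[- N, N]) c.
  rewrite Rintegral_cst//= lebesgue_measure_itv/= lte_fin.
  case: ifPn => [_|]; first by rewrite -EFinD/= opprK mulr2n.
  rewrite -leNgt => NN; have -> : N = 0 by apply/eqP; rewrite eq_le N0 andbT; lra.
  by rewrite mul0rn !mulr0.
apply: le_Rintegral => //.
- have cnf : continuous (fun t => `|f t|).
    by move=> t; apply: continuous_comp; [exact: cf|exact: norm_continuous].
  exact: continuous_itv_integrable.
- by apply: continuous_itv_integrable => t; exact: cvg_cst.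
Qed.

Lemma fourier_sq_le L N p q f xi : 0 <= L -> is_lipschitz L f ->
  supported p q f -> - N < p -> p < q -> q < N ->
  fourier_sq N f xi <= 2 * (L * (N *+ 2) * (N *+ 2)) ^+ 2.
Proof.
move=> L0 lf fpq Np pq qN; have cf := is_lipschitz_continuous lf.
have N0 : 0 <= N by lra.
have fN t : - N <= t <= N -> `|f t| <= L * (N *+ 2).
  move=> /andP[t1 t2]; have := lf t (- N); rewrite (fpq (- N)); last first.
    by left; exact: ltW.
  rewrite subr0 => /le_trans; apply; rewrite ler_wpM2l// opprK.
  by rewrite ger0_norm; rewrite ?mulr2n; lra.
have bnd (u : R) k : `|u| <= k -> u ^+ 2 <= k ^+ 2.
  move=> uk; rewrite -(real_normK (num_real u)) ler_pXn2r ?nnegrE//.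
  exact: le_trans uk.
rewrite /fourier_sq mulrDl mul1r lerD//.
  apply: bnd; apply: norm_itv_Rintegral_le => //.
    move=> t; apply: continuousM; first exact: cf.
  exact: continuous_cosM.
  move=> t tN; rewrite normrM -[leRHS]mulr1 ler_pM// ?fN//.
  by rewrite ler_norml cos_geN1 cos_le1.
apply: bnd; apply: norm_itv_Rintegral_le => //.
  move=> t; apply: continuousM; first exact: cf.
  exact: continuous_sinM.
move=> t tN; rewrite normrM -[leRHS]mulr1 ler_pM// ?fN//.
by rewrite sin_max.
Qed.

End averages.

(** * Infinitely many averages of finite total length *)

Section limit_average.
Context {R : realType}.
Local Notation mu := (@lebesgue_measure R).
Implicit Types (f : R -> R) (a c p q x y t N L xi : R).
Variables (A : nat -> seq R) (delta : R).
Hypothesis A_gt0 : forall n a, a \in A n -> 0 < a.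
Hypothesis A_le : forall n, \sum_(j < n) \sum_(a <- A j) a <= delta.

Fixpoint stage n := if n is n'.+1 then stage n' ++ A n' else [::].

Lemma big_stage (T : Type) (idx : T) (op : Monoid.law idx) (F : R -> T) n :
  \big[op/idx]_(a <- stage n) F a = \big[op/idx]_(j < n) \big[op/idx]_(a <- A j) F a.
Proof.
elim: n => [|n ih] /=; first by rewrite big_nil big_ord0.
by rewrite big_cat/= big_ord_recr/= ih.
Qed.

Let sigma n := \sum_(a <- stage n) a.

Lemma stage_gt0 n a : a \in stage n -> 0 < a.
Proof.
by elim: n => [//|n ih] /=; rewrite mem_cat => /orP[/ih//|]; exact: A_gt0.
Qed.

Lemma sum_stage_le n : \sum_(a <- stage n) a <= delta.
Proof. by rewrite big_stage. Qed.

Let delta_ge0 : 0 <= delta.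
Proof. by have := A_le 0; rewrite big_ord0. Qed.

Let A_sum_ge0 n : 0 <= \sum_(a <- A n) a.
Proof. by rewrite big_seq sumr_ge0// => a /A_gt0 /ltW. Qed.

Let sigmaS n : sigma n.+1 = sigma n + \sum_(a <- A n) a.
Proof. by rewrite /sigma /= big_cat. Qed.

Let sigma_cvg : cvgn sigma.
Proof.
apply: nondecreasing_is_cvgn.
  by apply/nondecreasing_seqP => n; rewrite sigmaS lerDl.
by exists delta => _ [n _ <-]; exact: sum_stage_le.
Qed.

Definition limit_average f x := limn (fun n => averages (stage n) f x).

(** Averaging over length [a] moves an [L]-Lipschitz function by at most [L * a];
adding [L * sigma n] therefore makes the sequence nondecreasing and bounded. *)
Lemma cvg_limit_average L f x : 0 <= L -> is_lipschitz L f ->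
  averages (stage n) f x @[n --> \oo] --> limit_average f x.
Proof.
move=> L0 lf; suff : cvgn (fun n => averages (stage n) f x) by [].
have -> : (fun n => averages (stage n) f x) =
    (fun n => (averages (stage n) f x + L * sigma n) - L * sigma n).
  by apply/funext => n; rewrite addrK.
apply: is_cvgB; last by apply: is_cvgMr; exact: sigma_cvg.
apply: nondecreasing_is_cvgn.
  apply/nondecreasing_seqP => n; rewrite sigmaS mulrDr addrA -subr_ge0.
  have := dist_averages x (@A_gt0 n) L0 (is_lipschitz_averages (@stage_gt0 n) lf).
  rewrite -averages_cat ler_norml => /andP[+ _]; rewrite /=; lra.
exists (f x + L * delta + L * delta) => _ [n _ <-].
have := dist_averages x (@stage_gt0 n) L0 lf; rewrite ler_norml => /andP[_].
have := ler_wpM2l L0 (sum_stage_le n); rewrite -/(sigma n); lra.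
Qed.

Lemma is_lipschitz_limit_average L f : 0 <= L -> is_lipschitz L f ->
  is_lipschitz L (limit_average f).
Proof.
move=> L0 lf x y.
have h : `|averages (stage n) f x - averages (stage n) f y| @[n --> \oo] -->
    `|limit_average f x - limit_average f y|.
  by apply: cvg_norm; apply: cvgB; exact: cvg_limit_average L0 lf.
apply: (cvgr_to_le h); near=> n.
exact: is_lipschitz_averages (@stage_gt0 n) lf _ _.
Unshelve. all: by end_near. Qed.

Lemma limit_average_itv_cst L f x c : 0 <= L -> is_lipschitz L f ->
  (forall y, x <= y <= x + delta -> f y = c) -> limit_average f x = c.
Proof.
move=> L0 lf fc; apply/cvg_lim => //.
rewrite (_ : (fun n => _) = cst c); first exact: cvg_cst.
apply/funext => n; apply: (averages_itv_cst (@stage_gt0 n) lf) => y /andP[xy yx].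
by apply: fc; rewrite xy (le_trans yx)// lerD2l sum_stage_le.
Qed.

Lemma supported_limit_average L p q f : 0 <= L -> is_lipschitz L f ->
  supported p q f -> supported (p - delta) q (limit_average f).
Proof.
move=> L0 lf fpq x [xp|xq]; apply: (limit_average_itv_cst L0 lf) => y /andP[xy yx];
    apply: fpq.
  by left; rewrite (le_trans yx)// -lerBrDr.
by right; rewrite (le_trans xq).
Qed.

(** The Lipschitz bound is part of the conclusion because the induction on [m]
needs it for the partial sums. *)
Lemma averages_sum s L (F : nat -> R -> R) m x : (forall a, a \in s -> 0 < a) ->
  0 <= L -> (forall k, is_lipschitz L (F k)) ->
  averages s (fun y => \sum_(k < m) F k y) x = \sum_(k < m) averages s (F k) x /\
  is_lipschitz (L *+ m) (fun y => \sum_(k < m) F k y).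
Proof.
move=> s0 L0 lF; elim: m => [|m [ih1 ih2]].
  have l0 : is_lipschitz 0 (fun y => \sum_(k < 0) F k y).
    by move=> y z; rewrite !big_ord0 subrr normr0 mul0r.
  split => //; rewrite big_ord0.
  by apply: (averages_itv_cst s0 l0) => y _; rewrite big_ord0.
have -> : (fun y => \sum_(k < m.+1) F k y) =
    ((fun y => \sum_(k < m) F k y) \+ F m).
  by apply/funext => y; rewrite big_ord_recr.
split; first by rewrite (averagesD _ s0 ih2 (lF m)) ih1 big_ord_recr.
move=> y z /=; rewrite opprD addrACA (le_trans (ler_normD _ _))//.
by rewrite mulrSr mulrDl lerD ?ih2 ?lF.
Qed.

Lemma sum_limit_average L (F : nat -> R -> R) m x c : 0 <= L ->
  (forall k, is_lipschitz L (F k)) ->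
  (forall y, x <= y <= x + delta -> \sum_(k < m) F k y = c) ->
  \sum_(k < m) limit_average (F k) x = c.
Proof.
move=> L0 lF Fc.
have [_ lS] := averages_sum m x (@stage_gt0 0) L0 lF.
rewrite -(limit_average_itv_cst _ lS Fc) ?mulrn_wge0//; apply/esym/cvg_lim => //.
under eq_fun => n do rewrite (averages_sum m x (@stage_gt0 n) L0 lF).1.
apply: cvg_big => [|k _]; last exact: cvg_limit_average L0 (lF k).
  exact: add_continuous.
Qed.

Lemma dist_limit_average L f x n : 0 <= L -> is_lipschitz L f ->
  `|averages (stage n) f x - limit_average f x| <= L * (limn sigma - sigma n).
Proof.
move=> L0 lf.
have h : `|averages (stage n) f x - averages (stage m) f x| @[m --> \oo] -->
    `|averages (stage n) f x - limit_average f x|.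
  apply: cvg_norm; apply: cvgB; first exact: cvg_cst.
  exact: cvg_limit_average L0 lf.
apply: (cvgr_to_le h); near=> m.
have nm : (n <= m)%N by near: m; exact: nbhs_infty_ge.
apply: (@le_trans _ _ (L * (sigma m - sigma n))); last first.
  rewrite ler_wpM2l// lerD2r; apply: nondecreasing_cvgn_le; last exact: sigma_cvg.
  by apply/nondecreasing_seqP => k; rewrite sigmaS lerDl.
rewrite -(subnKC nm); elim: (m - n)%N => [|k ih].
  by rewrite addn0 !subrr normr0 mulr0.
rewrite addnS (le_trans (ler_distD (averages (stage (n + k)) f x) _ _))//.
rewrite sigmaS addrAC mulrDr lerD// distrC /= averages_cat.
apply: dist_averages => //; first exact: A_gt0.
exact: is_lipschitz_averages (@stage_gt0 _) lf.
Unshelve. all: by end_near. Qed.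

(** The averages converge uniformly, and the integrals extend over a fixed
bounded interval. *)
Lemma cvg_fourier_sq L N f xi : 0 <= N -> 0 <= L -> is_lipschitz L f ->
  fourier_sq N (averages (stage n) f) xi @[n --> \oo] -->
  fourier_sq N (limit_average f) xi.
Proof.
move=> N0 L0 lf.
have cvg_int (k : R -> R) : continuous k -> (forall t, `|k t| <= 1) ->
    \int[mu]_(t in `[- N, N]) (averages (stage n) f t * k t) @[n --> \oo] -->
    \int[mu]_(t in `[- N, N]) (limit_average f t * k t).
  move=> ck k1; apply/cvgrPdist_le => e e0.
  have ctau : L * (limn sigma - sigma n) * (N *+ 2) @[n --> \oo] --> (0 : R).
    rewrite -(mul0r (N *+ 2)) -(mulr0 L) -(subrr (limn sigma)).
    apply: cvgMl; apply: cvgMr; apply: cvgB; first exact: cvg_cst.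
    exact: sigma_cvg.
  near=> n.
  have cav := is_lipschitz_continuous (is_lipschitz_averages (@stage_gt0 n) lf).
  have cli := is_lipschitz_continuous (is_lipschitz_limit_average L0 lf).
  have cM (g : R -> R) : continuous g -> continuous (fun t => g t * k t).
    by move=> cg t; apply: continuousM; [exact: cg|exact: ck].
  rewrite distrC -RintegralB//; [|exact/continuous_itv_integrable/cM..].
  apply: le_trans (_ : L * (limn sigma - sigma n) * (N *+ 2) <= _).
    apply: norm_itv_Rintegral_le => //.
      move=> t; apply: (@continuousB _ _ _ (fun t => averages (stage n) f t * k t)
        (fun t => limit_average f t * k t)); exact: cM.
    move=> t _; rewrite -mulrBl normrM -[leRHS]mulr1 ler_pM//.
    exact: dist_limit_average.
  near: n; have /cvgrPdist_le/(_ e e0) := ctau.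
  by apply: filterS => n; rewrite sub0r normrN; apply: le_trans; exact: ler_norm.
have cvg_sq (u : nat -> R) (l : R) : u n @[n --> \oo] --> l ->
    u n ^+ 2 @[n --> \oo] --> l ^+ 2.
  by move=> ul; rewrite expr2; under eq_fun do rewrite expr2; exact: cvgM.
rewrite /fourier_sq; apply: cvgD; apply: cvg_sq; apply: cvg_int;
  [exact: continuous_cosM| |exact: continuous_sinM|].
- by move=> t; rewrite ler_norml cos_geN1 cos_le1.
- by move=> t; rewrite sin_max.
Unshelve. all: by end_near. Qed.

(** Every factor of the product over all averages is at most [1], so all blocks
but the [j]-th can be dropped. *)
Lemma fourier_sq_limit_average L p q N f xi j : 0 <= L -> is_lipschitz L f ->
  supported p q f -> p < q -> - N < p - delta -> q < N -> xi != 0 ->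
  fourier_sq N (limit_average f) xi <=
  fourier_sq N f xi * \prod_(a <- A j) Num.min 1 (4 / (xi * a) ^+ 2).
Proof.
move=> L0 lf fpq pq Np qN xi0.
have N0 : 0 <= N by have := delta_ge0; lra.
apply: (cvgr_to_le (@cvg_fourier_sq L N f xi N0 L0 lf)); near=> n.
have jn : (j < n)%N by near: n; exact: nbhs_infty_gt.
apply: le_trans (fourier_sq_averages (@stage_gt0 n) lf fpq pq _ qN xi0) _.
  by rewrite (lt_le_trans Np)// lerD2l lerN2 sum_stage_le.
rewrite ler_wpM2l ?fourier_sq_ge0// big_stage (bigD1 (Ordinal jn))//=.
have F0 a : 0 <= Num.min 1 (4 / (xi * a) ^+ 2).
  by rewrite le_min ler01 divr_ge0// sqr_ge0.
have F1 a : Num.min 1 (4 / (xi * a) ^+ 2) <= 1 by rewrite ge_min lexx.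
rewrite ler_piMr//; first by apply: prodr_ge0.
rewrite prodr_ile1// => i _; rewrite prodr_ge0//=.
by rewrite prodr_ile1// => a _; rewrite F0/=.
Unshelve. all: by end_near. Qed.

End limit_average.

(** * Averages adapted to a weight *)

Section dyadic.
Context {R : realType}.
Local Notation mu := (@lebesgue_measure R).
Implicit Types (omega : R -> R) (t x : R).

(** On [2 ^+ j, 2 ^+ j.+1[ the integrand [omega t / t ^+ 2] is at least
[omega (2 ^+ j) / (2 ^+ j.+1) ^+ 2], so a simple function lies below it. *)
Lemma weight_dyadic_sum omega (w : weight omega) :
  exists S, forall n, \sum_(j < n) omega (2 ^+ j) / 2 ^+ j <= S.
Proof.
have w0 j : 0 <= omega (2 ^+ j) by rewrite (weight_ge0 w)// exprn_ge0.
pose I := (\int[mu]_(t in `[1%R, +oo[) (omega t / t ^+ 2)%:E)%E.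
exists (4 * fine I) => n.
pose D j : set R := `[2 ^+ j, 2 ^+ j.+1[%classic.
pose c j : R := omega (2 ^+ j) / (2 ^+ j.+1) ^+ 2.
have mD j : measurable_fun setT (fun x => (\1_(D j) x : R)%:E).
  by apply/measurable_EFinP; apply: measurable_indic; exact: measurable_itv.
have c0 j : 0 <= c j by rewrite divr_ge0// sqr_ge0.
have step : ((\sum_(j < n) c j * 2 ^+ j)%:E <= I)%E.
  rewrite -sumEFin; have -> : (\sum_(j < n) (c j * 2 ^+ j)%:E =
      \int[mu]_x \sum_(j < n) (c j)%:E * (\1_(D j) x)%:E)%E.
    rewrite ge0_integral_sum//.
    - apply: eq_bigr => j _; rewrite ge0_integralZl_EFin//.
        rewrite integral_indic//; last exact: measurable_itv.
        rewrite setIidl// /D/= lebesgue_measure_itv/= lte_fin.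
        rewrite ltr_eXn2l ?ltr1n// ltnSn -EFinD -EFinM; congr (_ * _)%:E.
        by rewrite exprS; ring.
      exact: mD.
    - by move=> j; apply: measurable_funeM; exact: mD.
    - by move=> j x _; rewrite -EFinM lee_fin mulr_ge0.
  rewrite /I [leRHS]integral_mkcond; apply: ge0_le_integral_nomeas => x.
    by apply: sume_ge0 => j _; rewrite -EFinM lee_fin mulr_ge0.
  rewrite patchE; under eq_bigr do rewrite -EFinM; rewrite sumEFin.
  have [[j jD]|nD] := pselect (exists j : 'I_n, D j x); last first.
    rewrite big1; last first.
      move=> j _; rewrite indicE memNset ?mulr0// => Dj; apply: nD; by exists j.
    case: ifPn; rewrite ?inE//= in_itv/= andbT => x1; rewrite lee_fin.
    by rewrite divr_ge0 ?sqr_ge0// (weight_ge0 w)// (le_trans ler01).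
  rewrite (bigD1 j)//= big1 ?addr0; last first.
    move=> i ij; rewrite indicE memNset ?mulr0//.
    move: jD; rewrite /D/= !in_itv/= => /andP[jx xj] /andP[ix xi].
    have : (j < i.+1)%N by rewrite -(@ltr_eXn2l R 2) ?ltr1n// (le_lt_trans jx).
    have : (i < j.+1)%N by rewrite -(@ltr_eXn2l R 2) ?ltr1n// (le_lt_trans ix).
    rewrite !ltnS => ij' ji; move/eqP: ij; apply.
    by apply/val_inj/eqP; rewrite eqn_leq ij' ji.
  rewrite indicE mem_set// mulr1.
  move: jD; rewrite /D/= in_itv/= => /andP[jx xj].
  have j1 : 1 <= 2 ^+ j :> R by rewrite exprn_ege1// ler1n.
  rewrite ifT; last by rewrite inE/= in_itv/= andbT (le_trans j1).
  rewrite lee_fin /c ler_pM ?invr_ge0 ?sqr_ge0//.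
    by apply: (weight_nondecreasing w) => //; rewrite (le_trans ler01).
  have x0 : 0 < x by rewrite (lt_le_trans ltr01)// (le_trans j1).
  by rewrite lef_pV2 ?posrE ?exprn_gt0// ler_pXn2r ?nnegrE ?(ltW x0) ?(ltW xj).
have Ifin : I \is a fin_num.
  rewrite ge0_fin_numE; first exact: (weight_integral w).
  apply: integral_ge0 => t /=; rewrite in_itv/= andbT => t1.
  by rewrite lee_fin divr_ge0 ?sqr_ge0// (weight_ge0 w)// (le_trans ler01).
move: step; rewrite -(fineK Ifin) lee_fin => /(ler_wpM2l (ler0n R 4)).
apply: le_trans; rewrite mulr_sumr ler_sum// => j _.
rewrite /c (exprS _ j); have : 2 ^+ j != 0 :> R by rewrite expf_neq0.
by move: (2 ^+ j) (omega _) => a b a0; rewrite le_eqVlt; apply/orP; left; apply/eqP; field.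
Qed.

Lemma exists_small_tail (u : nat -> R) (S delta : R) : (forall j, 0 <= u j) ->
  (forall n, \sum_(j < n) u j <= S) -> 0 < delta ->
  exists J, forall n, \sum_(j < n) u (J + j)%N <= delta.
Proof.
move=> u0 uS d0; pose E := range (fun n => \sum_(j < n) u j).
have hE : has_sup E.
  by split; [exists (\sum_(j < 0) u j), 0%N|exists S => _ [n _ <-]].
have [_ [J _ <-] HJ] := sup_adherent d0 hE.
exists J => n.
have : \sum_(j < J + n) u j <= sup E by apply: sup_upper_bound => //; exists (J + n)%N.
rewrite big_split_ord/=; lra.
Qed.

Lemma sum_half_powers n : \sum_(j < n) (2 ^+ j)^-1 <= 2 :> R.
Proof.
have : \sum_(j < n) (2 ^+ j)^-1 = 2 - 2 / 2 ^+ n :> R.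
  elim: n => [|n ih]; first by rewrite big_ord0 expr0 divr1 subrr.
  rewrite big_ord_recr/= ih exprS.
  have : 2 ^+ n != 0 :> R by rewrite expf_neq0.
  by move: (2 ^+ n) => a a0; field.
by move=> ->; rewrite gerBl divr_ge0// exprn_ge0.
Qed.

(** At a frequency between [2 ^+ j] and [2 ^+ j.+1], one average over length
[2 * expR 1 / 2 ^+ j] divides the squared Fourier transform by at least [expR 2],
so that the least integer above [omega (2 ^+ j.+1)] of them suffices for the
block [j]. The total length of the blocks is finite by [weight_dyadic_sum], and
small once finitely many blocks are dropped, which only affects low
frequencies. *)
Lemma exists_average_lengths omega (w : weight omega) (delta : R) : 0 < delta ->
  exists (A : nat -> seq R) (T : R), [/\ forall n a, a \in A n -> 0 < a,
    forall n, \sum_(j < n) \sum_(a <- A j) a <= delta &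
    forall xi, T <= `|xi| -> xi != 0 /\ exists j,
      \prod_(a <- A j) Num.min 1 (4 / (xi * a) ^+ 2) <= expR (- (2 * omega `|xi|))].
Proof.
move=> d0; have [S HS] := weight_dyadic_sum w.
have w0 j : 0 <= omega (2 ^+ j) by rewrite (weight_ge0 w)// exprn_ge0.
pose n_ j := (Num.truncn (omega (2 ^+ j.+1))).+1.
pose b j : R := 2 * expR 1 / 2 ^+ j.
have b0 j : 0 < b j by rewrite divr_gt0 ?exprn_gt0// mulr_gt0// expR_gt0.
pose u j := (n_ j)%:R * b j.
have u0 j : 0 <= u j by rewrite mulr_ge0// ltW.
have uS n : \sum_(j < n) u j <= 2 * expR 1 * (2 * S + 2).
  have e0 : 0 <= 2 * expR 1 :> R by rewrite mulr_ge0// expR_ge0.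
  apply: (@le_trans _ _ (\sum_(j < n) 2 * expR 1 *
      (2 * (omega (2 ^+ j) / 2 ^+ j) + (2 ^+ j)^-1))).
    apply: ler_sum => j _; rewrite /u /b.
    rewrite mulrCA ler_wpM2l//.
    have -> : 2 * (omega (2 ^+ j) / 2 ^+ j) + (2 ^+ j)^-1 =
      (2 * omega (2 ^+ j) + 1) / 2 ^+ j by ring.
    rewrite ler_wpM2r ?invr_ge0 ?exprn_ge0//.
    rewrite /n_ -natr1 lerD2r.
    have : omega (2 ^+ j.+1) <= 2 * omega (2 ^+ j).
      by rewrite exprS !mulr_natl !mulr2n (weight_subadditive w) ?exprn_ge0.
    by apply: le_trans; rewrite truncn_le.
  rewrite -mulr_sumr ler_wpM2l// big_split/= -mulr_sumr lerD ?sum_half_powers//.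
  by rewrite ler_wpM2l ?HS.
have [J HJ] := exists_small_tail u0 uS d0.
exists (fun j => nseq (n_ (J + j)%N) (b (J + j)%N)), (2 ^+ J); split.
- by move=> n a; rewrite mem_nseq => /andP[_ /eqP ->].
- move=> n; apply: le_trans (HJ n); apply: ler_sum => j _.
  by rewrite big_nseq iter_addr_0 /u mulr_natl.
- move=> xi Jxi.
  have xi0 : 0 < `|xi| by rewrite (lt_le_trans _ Jxi)// exprn_gt0.
  have xi1 : xi != 0 by rewrite -normr_gt0.
  split => //.
  have [m xim] : exists m, `|xi| < 2 ^+ m.
    exists (Num.truncn `|xi|).+1; apply: lt_le_trans (truncnS_gt _) _.
    by rewrite -natrX ler_nat ltnW// ltn_expl.
  have [k xik] : exists j, 2 ^+ (J + j) <= `|xi| < 2 ^+ (J + j).+1.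
    have [j Hj Hm] := @ex_minnP (fun m => `|xi| < 2 ^+ m) (ex_intro _ m xim).
    have Jj : (J < j)%N by rewrite -(@ltr_eXn2l R 2) ?ltr1n// (le_lt_trans Jxi).
    exists (j.-1 - J)%N; rewrite subnKC; last by rewrite -ltnS prednK// (leq_ltn_trans _ Jj).
    rewrite prednK ?Hj ?andbT ?(leq_ltn_trans _ Jj)// leNgt; apply/negP => /Hm.
    by rewrite leqNgt prednK ?leqnn// (leq_ltn_trans _ Jj).
  have [xk kx] := andP xik.
  exists k; rewrite big_nseq iter_mulr_1.
  have e2 : Num.min 1 (4 / (xi * b (J + k)%N) ^+ 2) <= expR (- 2).
    rewrite ge_min; apply/orP; right.
    rewrite expRN ler_pdivrMr; last first.
      by rewrite exprn_even_gt0//= mulf_neq0 ?xi1// gt_eqF.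
    rewrite mulrC ler_pdivlMr ?expR_gt0//.
    have : (2 * expR 1) ^+ 2 <= (xi * b (J + k)%N) ^+ 2.
      rewrite -(real_normK (num_real (_ * b _))) ler_pXn2r ?nnegrE//.
      rewrite normrM (gtr0_norm (b0 _)) /b mulrCA ler_pMr.
        by rewrite ler_pdivlMr ?exprn_gt0// mul1r.
      by rewrite mulr_gt0// expR_gt0.
    apply: le_trans; rewrite exprMn -expRM_natl mulr1.
    by rewrite le_eqVlt; apply/orP; left; apply/eqP; ring.
  apply: (@le_trans _ _ (expR (- 2) ^+ n_ (J + k)%N)).
    by rewrite ler_pXn2r ?nnegrE ?expR_ge0// le_min ler01 divr_ge0// sqr_ge0.
  rewrite -expRM_natl ler_expR mulrN lerN2 [leRHS]mulrC ler_wpM2l//.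
  apply: (@le_trans _ _ (omega (2 ^+ (J + k).+1))).
    by apply: (weight_nondecreasing w) => //; exact: ltW.
  by rewrite ltW// truncnS_gt.
Qed.


End dyadic.

(** * Partitions of unity on the line *)

Section partition_of_unity.
Context {R : realType}.
Implicit Types (omega : R -> R) (t x y xi delta : R).

Definition ramp x : R := Num.min 1 (Num.max 0 x).

Lemma ramp0 x : x <= 0 -> ramp x = 0.
Proof. by move=> x0; rewrite /ramp max_l// min_r. Qed.

Lemma ramp1 x : 1 <= x -> ramp x = 1.
Proof. by move=> x1; rewrite /ramp min_l// le_max x1 orbT. Qed.

Lemma is_lipschitz_ramp : is_lipschitz 1 ramp.
Proof.
suff H x y : x <= y -> `|ramp x - ramp y| <= y - x.
  move=> x y; rewrite mul1r; have [xy|/ltW xy] := leP x y.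
    by rewrite (le_trans (H _ _ xy))// distrC ler_norm.
  by rewrite distrC (le_trans (H _ _ xy))// ler_norm.
move=> xy; rewrite /ramp /Num.min /Num.max.
case: (ltP 0 x) => ?; case: (ltP 0 y) => ?; case: (ltP 1 x) => ?;
  case: (ltP 1 y) => ?; rewrite ?ltr10 ler_norml; apply/andP; split; lra.
Qed.

(** The hat function of height [1] and width [2 * delta] centred at
[(k - N) * delta]; as a difference of ramps it makes sums over [k] telescope. *)
Definition hat delta N k x : R :=
  ramp (x / delta + N.+1%:R - k%:R) - ramp (x / delta + N.+1%:R - k.+1%:R).

Variables (delta : R) (N : nat).
Hypothesis delta_gt0 : 0 < delta.

Let center k : R := (k%:R - N%:R) * delta.

Lemma is_lipschitz_hat k : is_lipschitz (2 / delta) (hat delta N k).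
Proof.
have H c : is_lipschitz delta^-1 (fun x => ramp (x / delta + c)).
  move=> x y; rewrite (le_trans (is_lipschitz_ramp _ _))// mul1r opprD addrACA subrr.
  by rewrite addr0 -mulrBl normrM mulrC ger0_norm// invr_ge0 ltW.
move=> x y; have := H (N.+1%:R - k%:R) x y; have := H (N.+1%:R - k.+1%:R) x y.
rewrite /hat !addrA.
set a := ramp (x / delta + _ - k.+1%:R); set a' := ramp (y / delta + _ - k.+1%:R).
set b := ramp (x / delta + _ - _); set b' := ramp (y / delta + _ - _).
move=> ha hb; rewrite (_ : b - a - (b' - a') = (b - b') - (a - a')); last by ring.
by rewrite (le_trans (ler_normB _ _))// !mulrDl !mul1r lerD.
Qed.

Lemma supported_hat k : supported (center k - delta) (center k + delta) (hat delta N k).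
Proof.
move=> x; rewrite /center /hat -!natr1 => -[xc|xc].
  have {}xc : x / delta <= k%:R - N%:R - 1.
    by rewrite ler_pdivrMr// mulrBl mul1r.
  by move: (x / delta) xc => u xc; rewrite !ramp0 ?subrr//; lra.
have {}xc : k%:R - N%:R + 1 <= x / delta.
  by rewrite ler_pdivlMr// mulrDl mul1r.
by move: (x / delta) xc => u xc; rewrite !ramp1 ?subrr//; lra.
Qed.

Lemma sum_hat x : `|x| <= N%:R * delta ->
  \sum_(k < (2 * N).+1) hat delta N k x = 1.
Proof.
rewrite -ler_pdivrMr// -[delta in X in X -> _](gtr0_norm delta_gt0) -normf_div.
rewrite ler_norml => /andP[x1 x2].
rewrite -(big_mkord xpredT (fun k => hat delta N k x)) /hat.
under eq_bigr do rewrite -opprB; rewrite sumrN telescope_sumr// opprB.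
rewrite subr0 ramp1 ?ramp0 ?subr0//; rewrite -!natr1 ?natrM; lra.
Qed.

(** The averaged hat functions: an average of total length [delta] spreads the
supports by [delta] to the left, and preserves the sum of the hat functions
where this sum is constant on the next interval of length [delta]. *)
Lemma exists_partition omega (w : weight omega) :
  exists (g : nat -> R -> R) (C : R), [/\ 0 <= C, forall k, continuous (g k),
    forall k, supported (center k - 2 * delta) (center k + delta) (g k),
    forall x, `|x| <= (N%:R - 1) * delta -> \sum_(k < (2 * N).+1) g k x = 1 &
    forall k xi, (k < (2 * N).+1)%N ->
      fourier_sq ((N%:R + 3) * delta) (g k) xi <= C * expR (- (2 * omega `|xi|))].
Proof.
have [A [T [A0 Ad AT]]] := exists_average_lengths w delta_gt0.
pose L := 2 / delta; have L0 : 0 <= L by rewrite divr_ge0// ltW.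
pose M := (N%:R + 3) * delta.
pose C0 := 2 * (L * (M *+ 2) * (M *+ 2)) ^+ 2.
have C00 : 0 <= C0 by rewrite mulr_ge0// sqr_ge0.
have lh k : is_lipschitz L (hat delta N k) by exact: is_lipschitz_hat.
have lg k := is_lipschitz_limit_average A0 Ad L0 (lh k).
have sg k : supported (center k - 2 * delta) (center k + delta)
    (limit_average A (hat delta N k)).
  have := supported_limit_average A0 Ad L0 (lh k) (@supported_hat k).
  by rewrite -addrA -opprD -mulr2n mulr_natl.
exists (fun k => limit_average A (hat delta N k)), (C0 * expR (2 * omega `|T|)).
split => //.
- by rewrite mulr_ge0// expR_ge0.
- by move=> k; exact: is_lipschitz_continuous (lg k).
- move=> x xN; apply: (sum_limit_average A0 Ad L0 lh) => y /andP[xy yx].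
  apply: sum_hat; move: xN; rewrite !ler_norml mulrBl mul1r => /andP[].
  by move=> ? ?; apply/andP; split; lra.
move=> k xi; rewrite ltnS => kN.
have /andP[k1 k2] : - (N%:R * delta) <= center k <= N%:R * delta.
  rewrite /center mulrBl; have : k%:R * delta <= 2 * (N%:R * delta).
    by rewrite mulrA ler_pM2r// -natrM ler_nat.
  have : 0 <= k%:R * delta by rewrite mulr_ge0// ltW.
  by move: (N%:R * delta) (k%:R * delta) => a b ? ?; apply/andP; split; lra.
have wT : 0 <= omega `|T| by exact: (weight_ge0 w).
have d0 : 0 < delta by [].
(* The limit is compared with the hat function at high frequencies, and bounded
   crudely at low frequencies, where [expR (- omega)] is bounded below. *)
have M1 : - M < center k - delta - delta by
  rewrite /M mulrDl; move: (center k) (N%:R * delta) k1 k2 => c a ? ?; lra.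
have M2 : center k + delta < M by
  rewrite /M mulrDl; move: (center k) (N%:R * delta) k1 k2 => c a ? ?; lra.
have M3 : center k - delta < center k + delta by move: (center k) => c; lra.
have [/AT[xi0 [j Hj]]|xT] := leP T `|xi|.
  rewrite (le_trans (fourier_sq_limit_average A0 Ad j L0 (lh k) (@supported_hat k)
    M3 M1 M2 xi0))//.
  apply: ler_pM => //; first exact: fourier_sq_ge0.
    by apply: prodr_ge0 => a _; rewrite le_min ler01 divr_ge0// sqr_ge0.
  apply: (@le_trans _ _ C0).
    by apply: (fourier_sq_le _ L0 (lh k) (@supported_hat k)) => //; lra.
  by rewrite ler_peMr// -expR0 ler_expR mulr_ge0.
rewrite -mulrA -expRD; apply: (@le_trans _ _ C0).
  by apply: (fourier_sq_le _ L0 (lg k) (sg k)) => //; lra.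
rewrite ler_peMr// -expR0 ler_expR subr_ge0 ler_wpM2l//.
by apply: (weight_nondecreasing w) => //; rewrite (le_trans (ltW xT))// ler_norm.
Qed.

End partition_of_unity.

(** * Integration of products over R^n *)

Section rV_integration.
Context {R : realType}.
Local Notation leb := (@lebesgue_measure R).
Local Notation mu n := (@lebesgue_rV R n).

Definition rV_belast n (x : 'rV[R]_n.+1) : 'rV[R]_n :=
  \row_i x 0 (widen_ord (leqnSn n) i).

Let widen_lift n (i : 'I_n) : widen_ord (leqnSn n) i = lift ord_max i.
Proof. by apply/val_inj; rewrite /= /bump leqNgt ltn_ord. Qed.

Lemma rV_rcons_widen n (p : 'rV[R]_n * R) i :
  rV_rcons p 0 (widen_ord (leqnSn n) i) = p.1 0 i.
Proof. by rewrite widen_lift mxE liftK. Qed.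

Lemma rV_rcons_max n (p : 'rV[R]_n * R) : rV_rcons p 0 ord_max = p.2.
Proof. by rewrite mxE unlift_none. Qed.

Lemma rV_belast_rcons n (p : 'rV[R]_n * R) : rV_belast (rV_rcons p) = p.1.
Proof. by apply/rowP => i; rewrite mxE rV_rcons_widen. Qed.

Lemma measurable_rV_belast n : measurable_fun [set: 'rV[R]_n.+1] (@rV_belast n).
Proof.
move=> _ A mA; rewrite setTI; move: A mA; apply: smallest_sub.
  split => [|A|F]; first by rewrite preimage_set0.
  - by move=> mA; rewrite setTD preimage_setC; exact: measurableC.
  - by move=> mF; rewrite preimage_bigcup; exact: bigcup_measurable.
move=> A; rewrite -bigcup_seq/= => -[i _ [B mB <-]]; rewrite setTI.
rewrite -comp_preimage -[X in measurable X]setTI.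
suff mi : measurable_fun setT
    ((fun x : 'rV[R]_n => x 0 i : measurableTypeR R) \o @rV_belast n).
  exact: mi.
apply: (eq_measurable_fun
  (fun x : 'rV[R]_n.+1 => x 0 (widen_ord (leqnSn n) i) : measurableTypeR R)).
  by move=> x _ /=; rewrite mxE.
exact: measurable_coord.
Qed.

Definition cube n (k : nat) : set 'rV[R]_n :=
  [set x | forall i, - k%:R <= x 0 i <= k%:R].

Arguments cube : clear implicits.

Lemma measurable_cube n k : measurable (cube n k).
Proof.
rewrite (_ : cube n k = \bigcap_(i in [set: 'I_n])
    ((fun x => x 0 i : measurableTypeR R) @^-1` `[- k%:R, k%:R])).
  apply: fin_bigcap_measurable => // i _; rewrite -[X in measurable X]setTI.
  by apply: measurable_coord.
apply/seteqP; split => x.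
  by move=> xk i _ /=; rewrite in_itv/=; exact: xk.
by move=> xk i; have := xk i I; rewrite /= in_itv.
Qed.

Lemma cube_exhaust n : \bigcup_k cube n k = setT.
Proof.
rewrite -subTset => x _; pose s := \sum_(i < n) `|x 0 i|.
exists (Num.truncn s).+1 => // i; rewrite -ler_norml.
apply: (@le_trans _ _ s); last by rewrite ltW// truncnS_gt.
by rewrite /s (bigD1 i)//= lerDl sumr_ge0.
Qed.

Lemma cube_finite n k : (mu n (cube n k) < +oo)%E.
Proof.
elim: n => [|n ih] /=.
  by apply: le_lt_trans (ltry 1); rewrite /dirac/= indicE lee_fin; case: (_ \in _).
rewrite /pushforward (_ : _ @^-1` _ = cube n k `*` `[- k%:R, k%:R]%classic).
  rewrite product_measure1E//; last exact: measurable_cube.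
  rewrite lte_mul_pinfty//; first by rewrite ge0_fin_numE.
  have := lebesgue_measure_itv `[(- k%:R : R), k%:R] => /= ->.
  by case: ifP => _; rewrite ?ltry// -EFinD ltry.
apply/seteqP; split => -[x t].
  move=> xk; split; last by have := xk ord_max; rewrite rV_rcons_max /= in_itv.
  by move=> i; have := xk (widen_ord (leqnSn n) i); rewrite rV_rcons_widen.
move=> [/= xk]; rewrite in_itv/= => tk i.
have [j ->|->] := unliftP ord_max i; last by rewrite rV_rcons_max.
by rewrite -widen_lift rV_rcons_widen.
Qed.

Let lebesgue_rV_sigma_finite n : sigma_finite setT (mu n).
Proof.
exists (cube n); first by rewrite cube_exhaust.
by move=> k; split; [exact: measurable_cube|exact: cube_finite].
Qed.

HB.instance Definition _ n := Measure_isSigmaFinite.Build _ _ _ (mu n)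
  (lebesgue_rV_sigma_finite n).

(** The measure of R^n.+1 is the image of the product of the measures of R^n and
R, so this is Fubini's theorem. *)
Lemma rV_tensor n (p : 'rV[R]_n -> R) (q : R -> R) :
  (mu n).-integrable setT (EFin \o p) -> leb.-integrable setT (EFin \o q) ->
  (mu n.+1).-integrable setT (EFin \o (fun x => p (rV_belast x) * q (x 0 ord_max))) /\
  \int[mu n.+1]_x (p (rV_belast x) * q (x 0 ord_max)) =
  (\int[mu n]_x p x) * \int[leb]_t q t.
Proof.
move=> ip iq.
have mp : measurable_fun setT p by apply/measurable_EFinP; exact: measurable_int ip.
have mq : measurable_fun setT q by apply/measurable_EFinP; exact: measurable_int iq.
pose h (z : 'rV[R]_n * measurableTypeR R) := (p z.1 * q z.2)%:E.
have mh : measurable_fun setT h.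
  apply/measurable_EFinP; apply: measurable_funM.
    by apply: measurableT_comp => //; exact: measurable_fst.
  by apply: measurableT_comp => //; exact: measurable_snd.
have ih : (mu n \x leb)%E.-integrable setT h.
  apply/(integrable12ltyP _ _ mh).
  rewrite (_ : (\int[mu n]_x _)%E = (\int[leb]_y `|(q y)%:E| * \int[mu n]_x `|(p x)%:E|)%E).
    apply: lte_mul_pinfty.
    - exact: integral_ge0.
    - by rewrite ge0_fin_numE; [case/integrableP : iq|exact: integral_ge0].
    - by case/integrableP : ip.
  rewrite -ge0_integralZl//.
  - apply: eq_integral => x _; rewrite muleC -ge0_integralZl//.
    + by apply: eq_integral => y _; rewrite /h EFinM abseM.
    + by apply: measurableT_comp => //; exact: measurable_int iq.
  - by apply: measurableT_comp => //; exact: measurable_int ip.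
  - exact: integral_ge0.
pose h' x := (p (rV_belast x) * q (x 0 ord_max))%:E.
have mh' : measurable_fun [set: 'rV[R]_n.+1] h'.
  apply/measurable_EFinP; apply: measurable_funM.
    by apply: measurableT_comp => //; exact: measurable_rV_belast.
  by apply: (measurableT_comp mq); exact: measurable_coord.
have hE : h' \o @rV_rcons R n = h.
  by apply/funext => z; rewrite /h' /h /= rV_belast_rcons rV_rcons_max.
have ih' : (mu n \x leb)%E.-integrable (@rV_rcons R n @^-1` setT) (h' \o @rV_rcons R n).
  by rewrite hE preimage_setT.
split; first exact: (integrable_pushforward (@measurable_rV_rcons R n) mh' ih').
rewrite /Rintegral.
have -> : (\int[mu n.+1]_x (p (rV_belast x) * q (x 0 ord_max))%:E =
    \int[mu n \x leb]_z h z)%E.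
  have := integral_pushforward (@measurable_rV_rcons R n) mh' ih' measurableT.
  by rewrite hE preimage_setT.
rewrite -(integral12_prod_meas1 ih) -fineM ?integrable_fin_num//.
congr fine; rewrite muleC -[X in (X * _)%E](fineK (integrable_fin_num _ iq))//.
rewrite -integralZl//; apply: eq_integral => x _.
transitivity (\int[leb]_y ((p x)%:E * (q y)%:E))%E.
  by apply: eq_integral => y _; rewrite /h EFinM.
by rewrite (integralZl _ iq)// -[in LHS](fineK (integrable_fin_num _ iq))// muleC.
Qed.

End rV_integration.
Arguments cube {R} n k.

Section complex_integration.
Context {R : realType}.
Local Notation leb := (@lebesgue_measure R).
Local Notation mu n := (@lebesgue_rV R n).

(** Integrability of a complex function, stated on the parts that the definition
of the Fourier transform integrates separately. *)
Definition cintegrable d (T : measurableType d) (m : set T -> \bar R) (f : T -> R[i]) :=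
  m.-integrable setT (EFin \o (fun x => complex.Re (f x))) /\
  m.-integrable setT (EFin \o (fun x => complex.Im (f x))).

Definition Cintegral1 (f : R -> R[i]) : R[i] :=
  (\int[leb]_t complex.Re (f t)) +i* (\int[leb]_t complex.Im (f t)).

Lemma integrable_EFinD d (T : measurableType d) (m : {measure set T -> \bar R})
    (f g : T -> R) :
  m.-integrable setT (EFin \o f) -> m.-integrable setT (EFin \o g) ->
  m.-integrable setT (EFin \o (fun x => f x + g x)).
Proof.
move=> fi gi; rewrite (_ : _ \o _ = (EFin \o f) \+ (EFin \o g))%E; last first.
  by apply/funext => x /=; rewrite EFinD.
exact: integrableD.
Qed.

Lemma integrable_EFinB d (T : measurableType d) (m : {measure set T -> \bar R})
    (f g : T -> R) :
  m.-integrable setT (EFin \o f) -> m.-integrable setT (EFin \o g) ->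
  m.-integrable setT (EFin \o (fun x => f x - g x)).
Proof.
move=> fi gi; rewrite (_ : _ \o _ = (EFin \o f) \- (EFin \o g))%E; last first.
  by apply/funext => x /=; rewrite EFinB.
exact: integrableB.
Qed.

Lemma cReM (a b : R[i]) :
  complex.Re (a * b) = complex.Re a * complex.Re b - complex.Im a * complex.Im b.
Proof. by case: a; case: b. Qed.

Lemma cImM (a b : R[i]) :
  complex.Im (a * b) = complex.Re a * complex.Im b + complex.Im a * complex.Re b.
Proof. by case: a; case: b. Qed.

Lemma cReD (a b : R[i]) : complex.Re (a + b) = complex.Re a + complex.Re b.
Proof. by case: a; case: b. Qed.

Lemma cImD (a b : R[i]) : complex.Im (a + b) = complex.Im a + complex.Im b.
Proof. by case: a; case: b. Qed.

Lemma cintegrable_sum n (I : eqType) (s : seq I) (f : I -> 'rV[R]_n -> R[i]) :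
  (forall i, i \in s -> cintegrable (mu n) (f i)) ->
  cintegrable (mu n) (fun x => \sum_(i <- s) f i x) /\
  Cintegral (fun x => \sum_(i <- s) f i x) = \sum_(i <- s) Cintegral (f i).
Proof.
elim: s => [_|i s ih fs].
  have -> : (fun x => \sum_(i <- [::]) f i x) = cst 0.
    by apply/funext => x; rewrite big_nil.
  split; first by split; exact: integrable0.
  rewrite big_nil /Cintegral /Rintegral /= integral0 /=.
  by [].
have [fi1 fi2] := fs i (mem_head _ _).
have [|[ih1 ih2] ih3] := ih; first by move=> j js; apply: fs; rewrite inE js orbT.
have -> : (fun x => \sum_(j <- i :: s) f j x) =
    (fun x => f i x + \sum_(j <- s) f j x).
  by apply/funext => x; rewrite big_cons.
rewrite big_cons -ih3; split.
  split.
    rewrite (_ : (fun x => _) = (fun x => complex.Re (f i x) +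
      complex.Re (\sum_(j <- s) f j x))); first exact: integrable_EFinD.
    by apply/funext => x; rewrite cReD.
  rewrite (_ : (fun x => _) = (fun x => complex.Im (f i x) +
    complex.Im (\sum_(j <- s) f j x))); first exact: integrable_EFinD.
  by apply/funext => x; rewrite cImD.
rewrite /Cintegral; apply/eqP; rewrite eq_complex/=; apply/andP; split; apply/eqP.
  by rewrite -RintegralD//; apply: eq_Rintegral => x _; rewrite cReD.
by rewrite -RintegralD//; apply: eq_Rintegral => x _; rewrite cImD.
Qed.

Lemma rV_Ctensor n (p : 'rV[R]_n -> R[i]) (q : R -> R[i]) :
  cintegrable (mu n) p -> cintegrable leb q ->
  cintegrable (mu n.+1) (fun x => p (rV_belast x) * q (x 0 ord_max)) /\
  Cintegral (fun x : 'rV[R]_n.+1 => p (rV_belast x) * q (x 0 ord_max)) =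
  Cintegral p * Cintegral1 q.
Proof.
move=> [p1 p2] [q1 q2].
have [i11 e11] := rV_tensor p1 q1; have [i12 e12] := rV_tensor p1 q2.
have [i21 e21] := rV_tensor p2 q1; have [i22 e22] := rV_tensor p2 q2.
split; first split.
- rewrite (_ : (fun x => _) = (fun x : 'rV[R]_n.+1 =>
      complex.Re (p (rV_belast x)) * complex.Re (q (x 0 ord_max)) -
      complex.Im (p (rV_belast x)) * complex.Im (q (x 0 ord_max)))).
    exact: integrable_EFinB.
  by apply/funext => x; rewrite cReM.
- rewrite (_ : (fun x => _) = (fun x : 'rV[R]_n.+1 =>
      complex.Re (p (rV_belast x)) * complex.Im (q (x 0 ord_max)) +
      complex.Im (p (rV_belast x)) * complex.Re (q (x 0 ord_max)))).
    exact: integrable_EFinD.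
  by apply/funext => x; rewrite cImM.
rewrite /Cintegral /Cintegral1; apply/eqP; rewrite eq_complex/=.
rewrite -e11 -e12 -e21 -e22 -RintegralB// -RintegralD//.
by apply/andP; split; apply/eqP; apply: eq_Rintegral => x _; rewrite ?cReM ?cImM.
Qed.

Lemma rV_Cprod n (f : 'I_n -> R -> R[i]) : (forall i, cintegrable leb (f i)) ->
  cintegrable (mu n) (fun x => \prod_(i < n) f i (x 0 i)) /\
  Cintegral (fun x : 'rV[R]_n => \prod_(i < n) f i (x 0 i)) =
  \prod_(i < n) Cintegral1 (f i).
Proof.
elim: n f => [|n ih] f intf.
  have -> : (fun x : 'rV[R]_0 => \prod_(i < 0) f i (x 0 i)) = cst 1.
    by apply/funext => x; rewrite big_ord0.
  have icst (c : R) : (mu 0).-integrable setT (EFin \o cst c).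
    by apply: finite_measure_integrable_cst; exact: measurableT.
  rewrite big_ord0; split; first by split; exact: icst.
  by rewrite /Cintegral !Rintegral_cst//= /dirac indicE mem_set// mulr1 mul0r.
have [ih1 ih2] := ih (fun i => f (widen_ord (leqnSn n) i)) (fun i => intf _).
have [t1 t2] := rV_Ctensor ih1 (intf ord_max).
have -> : (fun x : 'rV[R]_n.+1 => \prod_(i < n.+1) f i (x 0 i)) =
    (fun x => (\prod_(i < n) f (widen_ord (leqnSn n) i) (rV_belast x 0 i)) *
      f ord_max (x 0 ord_max)).
  apply/funext => x; rewrite big_ord_recr/=; congr (_ * _).
  by apply: eq_bigr => i _; rewrite mxE.
by split => //; rewrite t2 ih2 big_ord_recr.
Qed.

Lemma rV_prod_integrable n (u : R -> R) : leb.-integrable setT (EFin \o u) ->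
  (mu n).-integrable setT (EFin \o (fun x : 'rV[R]_n => \prod_(i < n) u (x 0 i))).
Proof.
move=> iu; have iuC : cintegrable leb (fun t => (u t)%:C).
  split => //=; exact: integrable0.
have [[+ _] _] := rV_Cprod (fun _ : 'I_n => iuC).
by under eq_fun do rewrite -rmorph_prod.
Qed.

End complex_integration.

Section weight_integrable.
Context {R : realType}.
Local Notation leb := (@lebesgue_measure R).

Lemma integrable_oneDsqrV :
  leb.-integrable setT (EFin \o (fun t : R => (oneDsqr t)^-1)).
Proof.
have m : measurable_fun setT (fun t : R => (oneDsqr t)^-1).
  by apply: continuous_measurable_fun; exact: continuous_oneDsqrV.
have ge0 (t : R) : 0 <= (oneDsqr t)^-1 by rewrite invr_ge0 (le_trans ler01)// oneDsqr_ge1.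
apply/integrableP; split; first exact/measurable_EFinP.
under eq_integral do rewrite /= ger0_norm//.
rewrite ge0_symfun_integralT//.
- rewrite (_ : [set x | 0 <= x] = `[0%R, +oo[%classic); last first.
    by apply/seteqP; split => t /=; rewrite in_itv/= andbT.
  by rewrite integral0y_oneDsqr -EFinM ltry.
- exact: continuous_oneDsqrV.
- by move=> t /=; rewrite /oneDsqr sqrrN.
Qed.

(** A weight exceeds [4 * ln (1 + t)] at infinity, so that [expR (- omega / 2)] is
at most [(1 + t) ^- 2] there. *)
Lemma integrable_expR_weight (omega : R -> R) (w : weight omega) :
  leb.-integrable setT (EFin \o (fun t => expR (- (omega `|t| / 2)))).
Proof.
have [T T0 HT] := weight_ln_le w 4.
have i1 : leb.-integrable setT (fun t => ((1 + T ^+ 2) * (oneDsqr t)^-1)%:E).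
  under eq_fun do rewrite EFinM.
  by apply: integrableZl => //; exact: integrable_oneDsqrV.
apply: (le_integrable _ _ _ i1) => //.
  apply/measurable_EFinP; apply: measurableT_comp => //.
  apply: continuous_measurable_fun => t; apply: cvgN; apply: cvgMl.
  exact: weight_continuous_norm.
move=> t _; have wt : 0 <= omega `|t| by exact: (weight_ge0 w).
have D0 : 0 < oneDsqr t by rewrite (lt_le_trans ltr01)// oneDsqr_ge1.
have T1 : 1 <= 1 + T ^+ 2 by rewrite lerDl sqr_ge0.
have r0 : 0 <= (1 + T ^+ 2) / oneDsqr t.
  by rewrite divr_ge0 ?(ltW D0)// (le_trans ler01).
rewrite /= lee_fin (ger0_norm (expR_ge0 _)) (ger0_norm r0).
rewrite ler_pdivlMr//.
have [/HT Tt|tT] := leP T `|t|.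
  apply: le_trans T1; rewrite -ler_pdivlMr// mul1r.
  have t1 : 0 < 1 + `|t| by rewrite ltr_pwDl.
  apply: (@le_trans _ _ (expR (- (2 * ln (1 + `|t|))))).
    rewrite ler_expR lerN2; move: Tt; move: (ln _) (omega _) => a b; lra.
  rewrite expRN expRM_natl lnK ?posrE// lef_pV2 ?posrE ?exprn_gt0//.
  rewrite /oneDsqr -[t ^+ 2](real_normK (num_real t)) sqrrD expr1n mul1r.
  by rewrite lerD2r lerDl mulrn_wge0.
rewrite -[leRHS]mul1r ler_pM ?expR_ge0 ?(ltW D0)//.
  by rewrite -expR0 ler_expR oppr_le0 divr_ge0.
by rewrite /oneDsqr lerD2l -(real_normK (num_real t)) ler_pXn2r ?nnegrE ?(ltW tT).
Qed.

End weight_integrable.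

(** * Cutoff functions *)

Section tensor_fourier.
Context {R : realType} {d : nat}.
Local Notation leb := (@lebesgue_measure R).
Local Notation mu := (@lebesgue_rV R d).
Implicit Types (g : R -> R) (s t p q M : R) (x xi : 'rV[R]_d).

Lemma Rintegral_supported g M : (forall t, ~ (- M <= t <= M) -> g t = 0) ->
  \int[leb]_t g t = \int[leb]_(t in `[- M, M]) g t.
Proof.
move=> gM; rewrite [RHS]Rintegral_mkcond; congr (Rintegral _ _ _).
apply/funext => t; rewrite patchE; case: ifPn => // tM; apply: gM => h.
by move/negP: tM; apply; rewrite inE/= in_itv.
Qed.

Lemma integrable_supported g M : continuous g ->
  (forall t, ~ (- M <= t <= M) -> g t = 0) -> leb.-integrable setT (EFin \o g).
Proof.
move=> cg gM.
have := continuous_itv_integrable (- M) M cg.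
rewrite integrable_mkcond//; congr (_.-integrable _ _).
apply/funext => t; rewrite patchE; case: ifPn => // tM; rewrite /= gM// => h.
by move/negP: tM; apply; rewrite inE/= in_itv.
Qed.

(** The integrand of the Fourier transform of [g] at the frequency [s]. *)
Definition wave g s t : R[i] := (g t)%:C * expi (- (t * s)).

Lemma wave_Re g s t : complex.Re (wave g s t) = g t * cos (s * t).
Proof. by rewrite /wave cReM/= mul0r subr0 cosN mulrC (mulrC t) mulrC. Qed.

Lemma wave_Im g s t : complex.Im (wave g s t) = - (g t * sin (s * t)).
Proof. by rewrite /wave cImM/= mul0r addr0 sinN (mulrC t) mulrN. Qed.

(** [g] vanishes outside [-M, M], so its integrals over the line are integrals over
[-M, M]. *)
Lemma wave_integrable g M s p q : continuous g -> supported p q g -> - M <= p ->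
  q <= M -> cintegrable leb (wave g s) /\
  normc (Cintegral1 (wave g s)) = Num.sqrt (fourier_sq M g s).
Proof.
move=> cg gpq Mp qM.
have g0 t : ~ (- M <= t <= M) -> g t = 0.
  move=> /negP; rewrite negb_and -!ltNge => /orP[tM|Mt]; apply: gpq.
    by left; rewrite (le_trans (ltW tM)).
  by right; rewrite (le_trans qM)// ltW.
have cgc : continuous (fun t => g t * cos (s * t)).
  by move=> t; apply: continuousM; [exact: cg|exact: continuous_cosM].
have cgs : continuous (fun t => g t * sin (s * t)).
  by move=> t; apply: continuousM; [exact: cg|exact: continuous_sinM].
have g0c t : ~ (- M <= t <= M) -> g t * cos (s * t) = 0 by move=> /g0 ->; rewrite mul0r.
have g0s t : ~ (- M <= t <= M) -> g t * sin (s * t) = 0 by move=> /g0 ->; rewrite mul0r.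
have ReE : (fun t => complex.Re (wave g s t)) = (fun t => g t * cos (s * t)).
  by apply/funext => t; exact: wave_Re.
have ImE : (fun t => complex.Im (wave g s t)) = (fun t => - (g t * sin (s * t))).
  by apply/funext => t; exact: wave_Im.
have cgsN : continuous (fun t => - (g t * sin (s * t))).
  by move=> t; apply: cvgN; exact: cgs.
split.
  split; rewrite ?ReE ?ImE; first exact: integrable_supported cgc g0c.
  by apply: (integrable_supported (M := M)) => // t /g0s ->; rewrite oppr0.
rewrite /Cintegral1 ReE ImE /normc; congr (Num.sqrt (_ + _)).
  by rewrite (Rintegral_supported g0c).
have -> : \int[leb]_t (- (g t * sin (s * t))) = - \int[leb]_t (g t * sin (s * t)).
  under eq_Rintegral do rewrite -mulN1r.
  rewrite RintegralZl ?mulN1r//; exact: integrable_supported cgs g0s.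
by rewrite sqrrN (Rintegral_supported g0s).
Qed.

Lemma normc_sum (I : Type) (r : seq I) (F : I -> R[i]) :
  normc (\sum_(i <- r) F i) <= \sum_(i <- r) normc (F i).
Proof.
elim: r => [|i r ih]; first by rewrite !big_nil normc0.
by rewrite !big_cons (le_trans (le_normcD _ _))// lerD2l.
Qed.

Lemma normc_prod (I : Type) (r : seq I) (F : I -> R[i]) :
  normc (\prod_(i <- r) F i) = \prod_(i <- r) normc (F i).
Proof. by apply: big_morph; [exact: normcM|exact: normc1]. Qed.

Lemma expi_sum (I : Type) (r : seq I) (F : I -> R) :
  expi (\sum_(i <- r) F i) = \prod_(i <- r) expi (F i).
Proof.
apply: (big_morph expi) => [a b|].
  apply/eqP; rewrite eq_complex cReM cImM/= cosD sinD.
  by rewrite eqxx /= addrC.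
by apply/eqP; rewrite eq_complex/= cos0 sin0 !eqxx.
Qed.

(** The exponential of a scalar product is a product over the coordinates, hence
so is the Fourier transform of each tensor product. *)
Lemma fourier_tensor (I : eqType) (r : seq I) (h : I -> 'I_d -> R -> R) M :
  (forall k i, k \in r -> continuous (h k i)) ->
  (forall k i, k \in r -> exists p q,
     [/\ supported p q (h k i), - M <= p & q <= M]) ->
  forall xi, let f := fun x => (\sum_(k <- r) \prod_(i < d) h k i (x 0 i))%:C in
  cintegrable mu (fun x => f x * expi (- dotr x xi)) /\
  normc (fourier f xi) <=
    \sum_(k <- r) \prod_(i < d) Num.sqrt (fourier_sq M (h k i) (xi 0 i)).
Proof.
move=> ch sh xi f.
have fE : (fun x => f x * expi (- dotr x xi)) =
    (fun x => \sum_(k <- r) \prod_(i < d) wave (h k i) (xi 0 i) (x 0 i)).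
  apply/funext => x; rewrite /f rmorph_sum/= mulr_suml; apply: eq_bigr => k _.
  rewrite rmorph_prod/= /dotr -sumrN expi_sum -big_split/=.
  by apply: eq_bigr.
have W k : k \in r -> forall i, cintegrable leb (wave (h k i) (xi 0 i)) /\
    normc (Cintegral1 (wave (h k i) (xi 0 i))) = Num.sqrt (fourier_sq M (h k i) (xi 0 i)).
  move=> kr i; have [p [q [hpq Mp qM]]] := sh k i kr.
  exact: wave_integrable (ch k i kr) hpq Mp qM.
have P k (kr : k \in r) := rV_Cprod (fun i => (W k kr i).1).
have [S1 S2] := cintegrable_sum (fun k kr => (P k kr).1).
rewrite /fourier fE; split => //.
rewrite S2 (le_trans (normc_sum _ _))// big_seq [leRHS]big_seq; apply: ler_sum => k kr.
rewrite (P k kr).2 normc_prod; apply: ler_prod => i _.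
by rewrite (W k kr i).2 sqrtr_ge0 lexx.
Qed.

Lemma enorm_le_sum xi : enorm xi <= \sum_(i < d) `|xi 0 i|.
Proof.
have S0 : 0 <= \sum_(i < d) `|xi 0 i| by exact: sumr_ge0.
rewrite /enorm -[leRHS]ger0_norm// -sqrtr_sqr ler_sqrt ?sqr_ge0//.
rewrite /dotr expr2 mulr_suml; apply: ler_sum => i _.
rewrite -expr2 -(real_normK (num_real _)) expr2 ler_wpM2l//.
by rewrite (bigD1 i)//= lerDl sumr_ge0.
Qed.

(** Subadditivity turns a radial weight into a sum over the coordinates, which
matches the decay of a product. *)
Lemma weight_enorm omega (w : weight omega) xi :
  omega (enorm xi) <= \sum_(i < d) omega `|xi 0 i|.
Proof.
apply: (@le_trans _ _ (omega (\sum_(i < d) `|xi 0 i|))).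
  by apply: (weight_nondecreasing w); [exact: sqrtr_ge0|exact: enorm_le_sum].
suff [] : 0 <= \sum_(i < d) `|xi 0 i| /\
  omega (\sum_(i < d) `|xi 0 i|) <= \sum_(i < d) omega `|xi 0 i| by [].
apply: (big_rec2 (fun a b => 0 <= a /\ omega a <= b)).
  by rewrite (weight0 w).
move=> i b a _ [a0 ab]; split; first by rewrite addr_ge0.
by rewrite (le_trans (weight_subadditive w _ _))// lerD2l.
Qed.

End tensor_fourier.

Section cutoff_construction.
Context {R : realType} {d : nat}.
Local Notation mu := (@lebesgue_rV R d).
Implicit Types (x y xi : 'rV[R]_d) (Omega K : set 'rV[R]_d).

(** Balls are cubes here since ['rV] carries the sup norm. *)
Lemma compact_thickening Omega K : open Omega -> compact K -> K `<=` Omega ->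
  exists2 r : R, 0 < r & forall x y, K x -> (forall i, `|x 0 i - y 0 i| < r) -> Omega y.
Proof.
move=> oO /compact_near_coveringP cK KO.
have : \forall e \near 0^'+, K `<=` (fun x => ball x e `<=` Omega).
  apply: cK => x Kx; have := oO; rewrite openE => /(_ x (KO x Kx)).
  rewrite /interior => /nbhs_ballP[e /= e0 xe].
  exists (ball x (e / 2), [set e' : R | 0 < e' < e / 2]) => /=.
    split; first by apply: nbhsx_ballx; rewrite divr_gt0.
    near=> u; apply/andP; split; near: u; first exact: nbhs_right_gt.
    by apply: nbhs_right_lt; rewrite divr_gt0.
  move=> [x' u] [/= xx' /andP[u0 ue]] y x'y; apply: xe.
  rewrite [e]splitr; apply: ball_triangle xx' _.
  by apply: le_ball x'y; exact: ltW.
move=> nK; have [r [Kr r0]] : exists r : R, K `<=` (fun x => ball x r `<=` Omega) /\ 0 < r.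
  near (0 : R)^'+ => r; exists r; split; near: r => //.
  exact: nbhs_right_gt.
exists r => // x y Kx xy; apply: (Kr x Kx); split => // i j.
by rewrite (ord1 i) /ball/=; exact: xy.
Unshelve. all: by end_near. Qed.

Lemma compact_coord_bounded K : compact K ->
  exists B : R, forall x i, K x -> `|x 0 i| <= B.
Proof.
move=> /compact_bounded[M [_ HM]]; exists (M + 1) => x i Kx.
have xM : `|x| <= M + 1 by apply: HM => //; rewrite ltrDl.
apply: le_trans xM.
rewrite [leRHS]/Num.Def.normr/= mx_normrE.
by apply/bigmax_geP; right; exists (0, i).
Qed.

(** The cutoff is the sum of those members of a tensor partition of unity whose
support meets [K]: the supports are small enough for the sum to be supported in
[Omega]. *)
Lemma exists_cutoff omega Omega K : weight omega -> open Omega -> compact K ->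
  K `<=` Omega -> exists psi, cutoff omega Omega K psi.
Proof.
move=> w oO cK KO.
have [r r0 Kr] := compact_thickening oO cK KO.
have [B KB] := compact_coord_bounded cK.
(* Each member of the partition is supported in an interval of length
   [3 * delta < r]. *)
have [delta d0 rE] : exists2 delta : R, 0 < delta & delta * 4 = r.
  by exists (r / 4); rewrite ?divr_gt0// mulfVK.
pose N := (Num.truncn (`|B| / delta)).+2.
have BN : B <= (N%:R - 1) * delta.
  rewrite -ler_pdivrMr// /N -natr1 addrK ltW//.
  apply: le_lt_trans (truncnS_gt _).
  by rewrite ler_pM2r ?invr_gt0// ler_norm.
have [g [C [C0 cg sg g1 Fg]]] := exists_partition N d0 w.
pose m := (2 * N).+1.
pose c k : R := (k%:R - N%:R) * delta.
pose box (k : {ffun 'I_d -> 'I_m}) : set 'rV[R]_d :=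
  [set x | forall i, (`[c (k i) - 2 * delta, c (k i) + delta]%classic : set R) (x ord0 i)].
pose good k := `[< exists2 x, K x & box k x >].
pose s := [seq k <- enum {ffun 'I_d -> 'I_m} | good k].
pose Psi x := \sum_(k <- s) \prod_(i < d) g (k i) (x 0 i).
have box_g k x : ~ box k x -> \prod_(i < d) g (k i) (x 0 i) = 0.
  move=> /existsNP[i /= ni]; rewrite (bigD1 i)//= (sg (k i)) ?mul0r//.
  move/negP: ni; rewrite in_itv/= negb_and -!ltNge => /orP[h|h]; [left|right]; exact: ltW.
pose K' := \big[setU/set0]_(k <- s) box k.
have cK' : compact K'.
  apply: bigsetU_compact => k _.
  apply: (@rV_compact R d (fun i => `[c (k i) - 2 * delta, c (k i) + delta]%classic)).
  by move=> i; exact: segment_compact.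
have K'O : K' `<=` Omega.
  move=> y; rewrite /K' -bigcup_seq => -[k /=].
  rewrite mem_filter => /andP[/asboolP[x Kx kx] _ ky].
  apply: (Kr x) => // i; have := kx i; have := ky i; rewrite /= !in_itv/=.
  move: (c (k i)) (x 0 i) (y 0 i) => a u v /andP[? ?] /andP[? ?].
  by rewrite ltr_norml; apply/andP; split; lra.
have Psi0 x : ~ K' x -> Psi x = 0.
  move=> nK'; rewrite /Psi big_seq big1// => k ks; apply: box_g => kx.
  by apply: nK'; rewrite /K' -bigcup_seq; exists k.
have Psi1 x : K x -> Psi x = 1.
  move=> Kx; rewrite /Psi big_filter big_enum_cond/=.
  rewrite (eq_bigl (fun k => (k \in predT) && good k))//.
  transitivity (\sum_(k : {ffun 'I_d -> 'I_m}) \prod_(i < d) g (k i) (x 0 i)).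
    rewrite [RHS](bigID good)/= [X in _ + X]big1 ?addr0//.
    by move=> k /asboolP nk; apply: box_g => kx; apply: nk; exists x.
  rewrite -(bigA_distr_bigA (fun (i : 'I_d) (j : 'I_m) => g j (x 0 i))).
  by apply: big1 => i _; apply: g1; rewrite (le_trans (KB x i Kx)).
have cPsi : continuous Psi.
  rewrite /Psi => x; apply: continuous_big => [|k _].
    exact: add_continuous.
  apply: continuous_big => [|i _]; first exact: mul_continuous.
  move=> y; apply: (@continuous_comp _ _ _ (fun x : 'rV[R]_d => x 0 i) (g (k i))).
    exact: coord_continuous.
  exact: cg.
pose psi x := (Psi x)%:C.
have zpsi : zext Omega psi = psi.
  apply/funext => x; rewrite /zext /patch; case: ifPn => // /negP xO.
  by rewrite /psi Psi0// => /K'O; rewrite -in_setE.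
pose M := (N%:R + 3) * delta.
have sM (k : 'I_m) : - M <= c k - 2 * delta /\ c k + delta <= M.
  have : k%:R * delta <= 2 * (N%:R * delta).
    by rewrite mulrA ler_pM2r// -natrM ler_nat -ltnS.
  have : 0 <= k%:R * delta by rewrite mulr_ge0// ltW.
  rewrite /M /c mulrBl (mulrDl N%:R); move: (N%:R * delta) (k%:R * delta) => a b ? ?.
  by split; lra.
have sh (k : {ffun 'I_d -> 'I_m}) (i : 'I_d) : k \in s -> exists p q,
    [/\ supported p q (g (k i)), - M <= p & q <= M].
  have [? ?] := sM (k i).
  by exists (c (k i) - 2 * delta), (c (k i) + delta); split => //; exact: sg.
have FT xi := @fourier_tensor R d _ s (fun k i => g (k i)) M
  (fun k i _ => cg (k i)) sh xi.
exists psi; split; last first.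
- by move=> x /Psi1; rewrite /psi => ->.
- rewrite (_ : (fun x => _) = cst 0)//.
  by apply: continuous_subspaceT => x; exact: cst_continuous.
- by apply: continuous_subspaceT; exact: cPsi.
split.
  by exists K'; split => //; apply: aeW => x [_ nK]; rewrite /psi Psi0.
(* Integrability of [psi] is the case of the frequency [0]. *)
have e1 x : expi (- dotr x 0) = 1 :> R[i].
  rewrite /dotr big1 => [|i _]; last by rewrite mxE mulr0.
  by rewrite oppr0 /expi cos0 sin0.
(* Half of the decay [expR (- omega)] absorbs the weight, the other half makes
   the bound integrable. *)
exists (1 / 2); first by rewrite divr_gt0.
rewrite zpsi /wnorm ifT; last first.
  apply/asboolP; exists psi; have [[i1 i2] _] := FT 0.
  split; last exact: aeW.
  - by move: i1; under eq_fun do rewrite e1 mulr1.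
  - by move: i2; under eq_fun do rewrite e1 mulr1.
pose W (t : R) := expR (- (omega `|t| / 2)).
pose D := Num.sqrt C; have D0 : 0 <= D by exact: sqrtr_ge0.
pose K1 := (size s)%:R * D ^+ d.
have bound xi : normc (fourier psi xi) * expR (1 / 2 * omega (enorm xi)) <=
    K1 * \prod_(i < d) W (xi 0 i).
  have FWi (k : 'I_m) (t : R) :
      Num.sqrt (fourier_sq M (g k) t) <= D * expR (- omega `|t|).
    apply: (@le_trans _ _ (Num.sqrt (C * expR (- (2 * omega `|t|))))).
      by rewrite ler_sqrt ?mulr_ge0 ?expR_ge0// Fg.
    rewrite sqrtrM// -mulrN expRM_natl sqrtr_sqr ger0_norm ?expR_ge0//.
  apply: (@le_trans _ _ ((\sum_(k <- s) \prod_(i < d) (D * expR (- omega `|xi 0 i|))) *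
      \prod_(i < d) expR (1 / 2 * omega `|xi 0 i|))).
    apply: ler_pM; [exact: sqrtr_ge0|exact: expR_ge0| |].
      apply: le_trans (FT xi).2 _; apply: ler_sum => k _; apply: ler_prod => i _.
      by rewrite sqrtr_ge0 FWi.
    rewrite -expR_sum ler_expR -mulr_sumr ler_wpM2l//; exact: weight_enorm.
  rewrite big_const_seq count_predT iter_addr_0.
  rewrite -[_ *+ size s]mulr_natl /K1 -!mulrA ler_wpM2l//.
  rewrite big_split/= prodr_const card_ord -mulrA ler_wpM2l ?exprn_ge0//.
  rewrite -big_split/= le_eqVlt; apply/orP; left; apply/eqP.
  by apply: eq_bigr => i _; rewrite -expRD /W; congr expR; field.
have iW : mu.-integrable setT (EFin \o (fun x : 'rV[R]_d => \prod_(i < d) W (x 0 i))).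
  exact: rV_prod_integrable (integrable_expR_weight w).
have iKW : mu.-integrable setT (fun x : 'rV[R]_d => (K1 * \prod_(i < d) W (x 0 i))%:E).
  by under eq_fun do rewrite EFinM; apply: integrableZl.
have [mKW] := integrableP _ _ _ iKW; apply: le_lt_trans.
apply: ge0_le_integral_nomeas => xi.
  by rewrite lee_fin mulr_ge0 ?expR_ge0// sqrtr_ge0.
by rewrite /= lee_fin (le_trans (bound xi))// ler_norm.
Qed.

End cutoff_construction.

(** * The projective description *)

Section wnorm_theory.
Context {R : realType} {d : nat}.
Local Notation mu := (@lebesgue_rV R d).
Implicit Types (f g psi phi : 'rV[R]_d -> R[i]) (Omega K : set 'rV[R]_d).
Implicit Types (omega sigma : R -> R) (l : R).

Lemma ae_eq_L1 f g : {ae mu, forall x, f x = g x} -> L1 f -> L1 g.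
Proof.
move=> fg [h [h1 h2 fh]]; exists h; split => //.
by apply: filterS2 fg fh => x <-.
Qed.

Lemma ae_eq_fourier f g xi : {ae mu, forall x, f x = g x} -> fourier f xi = fourier g xi.
Proof.
move=> fg; rewrite /fourier /Cintegral /Rintegral.
by congr (fine _ +i* fine _); apply: ae_eq_integral_nomeas;
  apply: filterS fg => x ->.
Qed.

Lemma ae_eq_wnorm sigma l f g : {ae mu, forall x, f x = g x} ->
  wnorm sigma l f = wnorm sigma l g.
Proof.
move=> fg; rewrite /wnorm.
have -> : L1 f = L1 g.
  apply/propext; split; apply: ae_eq_L1 => //.
  by apply: filterS fg => x ->.
case: ifP => [_|_]; last by [].
apply: eq_integral => xi _.
rewrite (ae_eq_fourier xi fg).
by [].
Qed.

Lemma wnorm_lty_L1 sigma l f : (wnorm sigma l f < +oo)%E -> L1 f.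
Proof. by rewrite /wnorm; case: ifPn => [/asboolP//|_]; rewrite ltxx. Qed.

Lemma ae_zext_mul psi phi Omega K : (forall x, K x -> psi x = 1) ->
  {ae mu, forall x, (Omega `\` K) x -> phi x = 0} ->
  {ae mu, forall x, zext Omega (fun x => psi x * phi x) x = zext Omega phi x}.
Proof.
move=> psi1; apply: filterS => x phi0; rewrite /zext /patch; case: ifPn => //.
rewrite inE => Ox; have [Kx|nKx] := pselect (K x); first by rewrite psi1// mul1r.
by rewrite phi0// mulr0.
Qed.

Lemma weight_ll_le omega omega' l : weight omega -> weight omega' ->
  weight_ll omega' omega -> 0 < l ->
  exists C, forall t, 0 <= t -> omega' t <= l * omega t + C.
Proof.
move=> w w' ll l0; have [T [_ HT]] := ll l l0.
have t0 : 0 <= `|T| + 1 by rewrite addr_ge0.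
exists (omega' (`|T| + 1)) => t tge0.
have wt : 0 <= omega t by exact: (weight_ge0 w).
have wT : 0 <= omega' (`|T| + 1) by exact: (weight_ge0 w').
have [tT|Tt] := leP t (`|T| + 1).
  apply: (le_trans (weight_nondecreasing w' tge0 tT)).
  by rewrite lerDr mulr_ge0// ltW.
have /HT : T < t by rewrite (le_lt_trans (ler_norm T))// (lt_trans _ Tt)// ltrDl.
rewrite (ger0_norm wt) => h; rewrite (le_trans (ler_norm _))// (le_trans h)//.
by rewrite lerDl.
Qed.

(** The norm only grows by the factor [expR C] of [weight_ll_le]. *)
Lemma wnorm_weight_ll omega omega' l f : weight omega -> weight omega' ->
  weight_ll omega' omega -> 0 < l -> (wnorm omega l f < +oo)%E ->
  (wnorm omega' 1 f < +oo)%E.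
Proof.
move=> w w' ll l0 fl; have fL := wnorm_lty_L1 fl.
move: fl; rewrite /wnorm !ifT; [|exact/asboolP|exact/asboolP] => fl.
have [C HC] := weight_ll_le w w' ll l0.
have nn (s : R -> R) (a : R) xi :
    (0 <= (normc (fourier f xi) * expR (a * s (enorm xi)))%:E)%E.
  by rewrite lee_fin mulr_ge0 ?expR_ge0// sqrtr_ge0.
apply: le_lt_trans (ge0_integralZl_lty (expR_gt0 C) (nn omega l) fl).
apply: ge0_le_integral_nomeas => // xi.
rewrite -EFinM lee_fin mulrCA ler_wpM2l ?sqrtr_ge0// -expRD ler_expR mul1r addrC.
by apply: HC; exact: sqrtr_ge0.
Qed.

Lemma cube_enorm_le n (x : 'rV[R]_d) : cube d n x -> enorm x <= (d * n)%:R.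
Proof.
move=> xn; rewrite (le_trans (enorm_le_sum x))// mulnC natrM.
rewrite -[d in leRHS]card_ord mulr_natr -sumr_const; apply: ler_sum => i _.
by rewrite ler_norml; exact: xn.
Qed.

(** If every exponent [omega / n.+1] gave an infinite norm, each could be
exhausted up to the value [n] on a cube, and a single weight negligible with
respect to [omega], but above [omega / n.+1] on the [n]-th cube, would give an
infinite norm too. *)
Lemma exists_wnorm_lty omega f : weight omega ->
  (forall omega', weight omega' -> weight_ll omega' omega ->
    (wnorm omega' 1 f < +oo)%E) ->
  exists2 l : R, 0 < l & (wnorm omega l f < +oo)%E.
Proof.
move=> w fw; apply: contrapT => nl.
have [sigma1 [w1 ll1 _]] := exists_weight_ll w (fun=> 0).
have fL := wnorm_lty_L1 (fw _ w1 ll1).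
pose F a xi := (normc (fourier f xi) * expR a)%:E : \bar R.
have F0 a xi : (0 <= F a xi)%E by rewrite lee_fin mulr_ge0 ?expR_ge0// sqrtr_ge0.
have Foo n : (\int[mu]_xi F (n.+1%:R^-1 * omega (enorm xi))%R xi = +oo)%E.
  apply/eqP; apply: contra_notT nl; rewrite -ltey => Flty.
  exists n.+1%:R^-1; first by rewrite invr_gt0.
  by rewrite /wnorm ifT//; exact/asboolP.
have /choice[k Hk] : forall n, exists k : nat, ((n%:R : R)%:E <= \int[mu]_xi
    ((fun xi => F (n.+1%:R^-1 * omega (enorm xi))%R xi) \_ (cube d k)) xi)%E.
  move=> n; apply: exhaust_integral_pinfty => //.
  - move=> i j ij; apply/subsetPset => x xi m; rewrite -ler_norml.
    by rewrite (le_trans _ (_ : i%:R <= _))// ?ler_nat// ler_norml; exact: xi.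
  - by move=> i; exact: measurable_cube.
  - exact: cube_exhaust.
have [sigma2 [w2 ll2 Ho]] := exists_weight_ll w (fun n => omega (d * k n)%:R).
have sigma2n n : ((n%:R : R)%:E <= wnorm sigma2 1 f)%E.
  rewrite /wnorm ifT; last exact/asboolP.
  apply: le_trans (Hk n) _; apply: ge0_le_integral_nomeas => xi.
    by rewrite patchE; case: ifP.
  rewrite patchE; case: ifPn => [|_]; last exact: F0.
  rewrite inE => xin; rewrite lee_fin ler_wpM2l ?sqrtr_ge0// ler_expR mul1r mulrC.
  apply: Ho; first exact: sqrtr_ge0.
  apply: (weight_nondecreasing w); first exact: sqrtr_ge0.
  exact: cube_enorm_le.
have := fw _ w2 ll2; rewrite ltNge => /negP; apply.
rewrite leye_eq; apply/eqP/eqyP => A A0.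
apply: le_trans (sigma2n (Num.truncn A).+1); rewrite lee_fin.
exact/ltW/truncnS_gt.
Qed.

End wnorm_theory.

Theorem theorem3p3 (R : realType) (d : nat) (hd : (0 < d)%N)
    (Omega : set 'rV[R]_d) (hOmega : open Omega)
    (omega : R -> R) (homega : weight omega)
    (phi : 'rV[R]_d -> R[i]) (hphi : compact_support_in Omega phi) :
  test_function omega Omega phi <->
  (forall K : set 'rV[R]_d, compact K -> K `<=` Omega ->
   forall omega' : R -> R, weight omega' -> weight_ll omega' omega ->
   (local_wnorm omega Omega K omega' 1 phi < +oo)%E).
Proof.
split => [[[K0 [cK0 K0O phi0]] [l l0 phil]] K cK KO sigma' w' ll|H].
  have cKK : compact (K `|` K0) by exact: compactU.
  have KKO : K `|` K0 `<=` Omega by move=> x [/KO|/K0O].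
  have [psi [tpsi cRe cIm psi1]] := exists_cutoff homega hOmega cKK KKO.
  apply: (@le_lt_trans _ _ (wnorm sigma' 1 (zext Omega (fun x => psi x * phi x)))).
    apply: ereal_inf_lbound; exists psi => //; split => // x Kx.
    by apply: psi1; left.
  rewrite (ae_eq_wnorm _ _ (ae_zext_mul (K := K0) _ phi0)).
    exact: wnorm_weight_ll homega w' ll l0 phil.
  by move=> x K0x; apply: psi1; right.
split => //; have [K0 [cK0 K0O phi0]] := hphi.
apply: exists_wnorm_lty => // sigma' w' ll.
have [psi' [psi [_ _ _ psi1] <-] psilt] := ereal_inf_lt (H K0 cK0 K0O sigma' w' ll).
by move: psilt; rewrite (ae_eq_wnorm _ _ (ae_zext_mul psi1 phi0)).
Qed.
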